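(* Suppose $\mathbb{E}_{P_0}K_{P_0}(X,X)<\infty$, Stein's identity $\mathbb{E}_{P_0}\xi_{P_0}(X)=0$ holds, and $\operatorname{tr}(C_\star^2)>0$. For every fixed $A\ge4$ there exists a constant $c>0$, independent of $n$, such that for all sufficiently large $n$, \[ \inf_{\widehat T}\ \sup_{P\in\mathcal{P}(A)}\ \mathbb{E}_P\bigl|\widehat T-\mathrm{KSD}(P_0,P)\bigr|\ \ge\ c\,\sqrt{\frac{\|C_\star\|_{\mathrm{HS}}}{n}}, \] where the infimum is over all estimators $\widehat T$ based on $n$ i.i.d. samples from $P$.
   Context: $P_0$ is a fixed probability distribution on $\mathcal{X}\subseteq\mathbb{R}^d$ with a continuously differentiable, everywhere positive density $p_0$; its score is $s_0(x)=\nabla\log p_0(x)$. $k\in C^{1,1}(\mathcal{X}\times\mathcal{X})$ is a positive definite kernel with reproducing kernel Hilbert space $\mathcal{H}_k$, and $\mathcal{H}:=\mathcal{H}_k^d$. The Langevin--Stein feature map is $\xi_{P_0}(x):=s_0(x)k(x,\cdot)+\nabla_x k(x,\cdot)\in\mathcal{H}$, and the Stein kernel is $K_{P_0}(x,y):=\langle\xi_{P_0}(x),\xi_{P_0}(y)\rangle_{\mathcal{H}}$. Every sampling distribution $P$ considered is assumed to satisfy $\mathbb{E}_PK_{P_0}(X,X)<\infty$; for such $P$ the Stein mean embedding is the Bochner integral $\mu_P:=\mathbb{E}_P\xi_{P_0}(X)$ and $\mathrm{KSD}(P_0,P):=\|\mu_P\|_{\mathcal{H}}$. The Stein covariance operator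 is $C_\star:=\mathbb{E}_{P_0}[\xi_{P_0}(X)\otimes\xi_{P_0}(X)]$ on $\mathcal{H}$, where $a\otimes b$ is the operator $x\mapsto\langle b,x\rangle a$; it is positive, self-adjoint and trace class, and $\|C_\star\|_{\mathrm{HS}}=\operatorname{tr}(C_\star^2)^{1/2}$. For $A\ge1$, \[ \mathcal{P}(A):=\bigl\{P:\ \mathbb{E}_{P\otimes P}K_{P_0}(X,Y)^2\le A\,\operatorname{tr}(C_\star^2)\bigr\}, \] where $X,Y\sim P$ are independent and $P$ ranges over probability measures on $\mathcal{X}$ (with $\mathbb{E}_PK_{P_0}(X,X)<\infty$). An estimator is a real-valued measurable function of the sample $(X_1,\dots,X_n)$, and $\mathbb{E}_P$ denotes expectation when $X_1,\dots,X_n$ are i.i.d. from $P$. *)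

(* Defs.v *)
From HB Require Import structures.
From mathcomp Require Import all_boot all_order all_algebra.
From mathcomp Require Import all_classical all_reals all_analysis.
From mathcomp Require Import measurable_realfun ring.

Set Implicit Arguments.
Unset Strict Implicit.
Unset Printing Implicit Defensive.
Import Order.TTheory GRing.Theory Num.Theory.
Import numFieldNormedType.Exports.
Local Open Scope classical_set_scope.
Local Open Scope ring_scope.

HB.mixin Record isHilbert (R : realType) V of CompleteNormedModule R V := {
  inner : V -> V -> R ;
  innerC : forall x y, inner x y = inner y x ;
  inner_linearl : forall y a x z,
    inner (a *: x + z) y = a * inner x y + inner z y ;
  inner_normE : forall x, inner x x = `|x| ^+ 2
}.

#[short(type="hilbertType")]
HB.structure Definition Hilbert (R : realType) :=
  {V of CompleteNormedModule R V & isHilbert R V}.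

(* The Hilbert direct sum of d copies of V. *)
Definition hpow (d : nat) (V : Type) := {ffun 'I_d -> V}.

Section hpow.
Context (R : realType) (d : nat) (V : hilbertType R).
Local Notation W := (hpow d V).

HB.instance Definition _ := GRing.Lmodule.on W.

Definition hpow_inner (f g : W) : R := \sum_(i < d) inner (f i) (g i).
Definition hpow_norm (f : W) : R := Num.sqrt (hpow_inner f f).

Let ipC f g : hpow_inner f g = hpow_inner g f.
Proof. by apply: eq_bigr => i _; rewrite innerC. Qed.

Let ip_linl g a f h :
  hpow_inner (a *: f + h) g = a * hpow_inner f g + hpow_inner h g.
Proof.
rewrite /hpow_inner mulr_sumr -big_split; apply: eq_bigr => i _ /=.
by rewrite !ffunE inner_linearl.
Qed.

Let ipE f : hpow_inner f f = \sum_(i < d) `|f i| ^+ 2.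
Proof. by apply: eq_bigr => i _; rewrite inner_normE. Qed.

Let ip_ge0 f : 0 <= hpow_inner f f.
Proof. by rewrite ipE sumr_ge0// => i _; rewrite exprn_ge0. Qed.

Let ip_eq0 f : hpow_inner f f = 0 -> f = 0.
Proof.
rewrite ipE => /eqP; rewrite psumr_eq0; last by move=> i _; rewrite exprn_ge0.
move=> /allP f0; apply/ffunP => i; rewrite ffunE.
have := f0 i; rewrite mem_index_enum => /(_ isT).
by rewrite sqrf_eq0 normr_eq0 => /eqP.
Qed.

Let ip0l f : hpow_inner 0 f = 0.
Proof. by rewrite /hpow_inner big1// => i _; rewrite ffunE; have := inner_linearl (f i) (-1) 0 0; rewrite scaleN1r oppr0 addr0 mulN1r addNr. Qed.

Let ipDl f g h : hpow_inner (f + g) h = hpow_inner f h + hpow_inner g h.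
Proof. by rewrite -[f]scale1r ip_linl mul1r scale1r. Qed.

Let ipZl a f g : hpow_inner (a *: f) g = a * hpow_inner f g.
Proof. by have := ip_linl g a f 0; rewrite !addr0 ip0l addr0. Qed.

Let ipDr f g h : hpow_inner f (g + h) = hpow_inner f g + hpow_inner f h.
Proof. by rewrite ipC ipDl ipC (ipC h). Qed.

Let ipZr a f g : hpow_inner f (a *: g) = a * hpow_inner f g.
Proof. by rewrite ipC ipZl ipC. Qed.

Let sq_norm f : hpow_norm f ^+ 2 = hpow_inner f f.
Proof. by rewrite sqr_sqrtr. Qed.

Let norm_eq0 f : hpow_norm f = 0 -> f = 0.
Proof. by move=> f0; apply: ip_eq0; rewrite -sq_norm f0 expr0n. Qed.

Let normZ a f : hpow_norm (a *: f) = `|a| * hpow_norm f.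
Proof.
by rewrite /hpow_norm ipZl ipZr mulrA -expr2 sqrtrM ?sqr_ge0// sqrtr_sqr.
Qed.

Let CS f g : hpow_inner f g <= hpow_norm f * hpow_norm g.
Proof.
have [g0|g0] := eqVneq (hpow_norm g) 0.
  by rewrite g0 mulr0 (norm_eq0 g0) ipC ip0l.
have gp : 0 < hpow_norm g by rewrite lt_def g0 sqrtr_ge0.
have := ip_ge0 (hpow_norm g *: f - hpow_norm f *: g).
rewrite -scaleNr ipDl !ipDr !ipZl !ipZr -!sq_norm (ipC g f).
have [f0|f0] := eqVneq (hpow_norm f) 0.
  by rewrite f0 mul0r (norm_eq0 f0) ip0l.
have fp : 0 < hpow_norm f by rewrite lt_def f0 sqrtr_ge0.
set a := hpow_norm f; set b := hpow_norm g; set p := hpow_inner f g.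
rewrite (_ : _ + _ = (2 * (a * b)) * (a * b - p)); last first.
  rewrite !mulNr !mulrN opprK mulrBr -!mulrA.
  by rewrite -/a -/b !expr2; ring.
by rewrite pmulr_rge0 ?subr_ge0// !mulr_gt0.
Qed.

Let normD f g : hpow_norm (f + g) <= hpow_norm f + hpow_norm g.
Proof.
rewrite -(@ler_pXn2r _ 2)// ?nnegrE ?addr_ge0 ?sqrtr_ge0//.
rewrite sq_norm ipDl !ipDr -!sq_norm sqrrD (ipC g f).
rewrite addrA -(addrA (_ ^+ 2)) lerD2r lerD2l -mulr2n lerMn2r /=.
exact: CS.
Qed.

HB.instance Definition _ := Lmodule_isNormed.Build R W normD normZ norm_eq0.

Let hnormE (f : W) : `|f| = hpow_norm f. Proof. by []. Qed.

Let coord_le (f : W) i : `|f i| <= `|f|.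
Proof.
rewrite hnormE -(@ler_pXn2r _ 2)// ?nnegrE ?sqrtr_ge0//.
by rewrite sq_norm ipE (bigD1 i)//= lerDl sumr_ge0// => j _; rewrite exprn_ge0.
Qed.

Let le_coord (f : W) : `|f| <= \sum_(i < d) `|f i|.
Proof.
have s0 : 0 <= \sum_(i < d) `|f i| by apply: sumr_ge0.
rewrite hnormE -(@ler_pXn2r _ 2)// ?nnegrE ?sqrtr_ge0//.
rewrite sq_norm ipE expr2 mulr_suml; apply: ler_sum => i _.
by rewrite expr2 ler_wpM2l// (bigD1 i)//= lerDl sumr_ge0.
Qed.

Let hpow_complete (F : set_system W) : ProperFilter F -> cauchy F -> cvg F.
Proof.
move=> FF /cauchy_ballP Fc.
have cvgi i : cvg ((fun f : W => f i) @ F).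
  apply: cauchy_cvg; apply/cauchy_ballP => e e0.
  have [[A B] /= [FA FB] AB] := Fc _ e0.
  exists ((fun f : W => f i) @` A, (fun f : W => f i) @` B) => /=.
    by split; [apply: filterS FA|apply: filterS FB] => f ?; exists f.
  move=> [_ _] /= [[f Af <-] [g Bg <-]]; have := AB (f, g) (conj Af Bg).
  rewrite -!ball_normE /=; apply: le_lt_trans.
  by have := coord_le (f - g) i; rewrite !ffunE.
pose L : W := [ffun i => lim ((fun f : W => f i) @ F)].
apply/cvg_ex; exists L; apply/cvgrPdist_lt => e e0.
have ed0 : 0 < e / d.+1%:R by rewrite divr_gt0.
have : F [set f : W | forall i, `|L i - f i| < e / d.+1%:R].
  apply: filter_forall => i; rewrite ffunE.
  by have /cvgrPdist_lt := cvgi i; exact.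
apply: filterS => f Lf; apply: le_lt_trans (le_coord _) _.
apply: (@le_lt_trans _ _ (\sum_(i < d) e / d.+1%:R)).
  by apply: ler_sum => i _; have /ltW := Lf i; rewrite !ffunE.
rewrite sumr_const card_ord -[ltLHS]mulr_natr mulrAC ltr_pdivrMr// ltr_pM2l//.
by rewrite ltr_nat.
Qed.

HB.instance Definition _ := Uniform_isComplete.Build W hpow_complete.

HB.instance Definition _ :=
  isHilbert.Build R W ipC ip_linl (fun f => esym (sq_norm f)).

End hpow.

Section operators.
Context (R : realType) (V : hilbertType R).
Implicit Types (B : set V) (S : V -> V).

Definition orthonormal B :=
  forall e f, B e -> B f -> inner e f = (e == f)%:R.

Definition orthonormal_basis B :=
  orthonormal B /\ forall x, (forall e, B e -> inner x e = 0) -> x = 0.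

Let inner0 (x : V) : inner 0 x = 0.
Proof.
by have := inner_linearl x (-1) 0 0; rewrite scaler0 addr0 mulN1r addNr.
Qed.

Lemma ex_orthonormal_basis : exists B, orthonormal_basis B.
Proof.
have [F FP tF|B [oB maxB]] := @Zorn_bigcup V [set B | orthonormal B].
  move=> e f [B FB Be] [C FC Cf].
  have [BC|CB] := tF _ _ FB FC.
    by apply: (FP _ FC) => //; exact: BC.
  by apply: (FP _ FB) => //; exact: CB.
exists B; split=> // x xB; apply: contrapT => /eqP x0.
have nx0 : `|x| != 0 by rewrite normr_eq0.
pose u := `|x|^-1 *: x.
have uB e : B e -> inner u e = 0.
  move=> /xB xe; have := inner_linearl e `|x|^-1 x 0.
  by rewrite addr0 xe mulr0 inner0 addr0.
have uu : inner u u = 1.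
  by rewrite inner_normE normrZ normfV normr_id mulVf// expr1n.
have nBu : ~ B u by move=> /uB; rewrite uu => /eqP; rewrite oner_eq0.
apply: (maxB (B `|` [set u])) => [|e f].
  split; first by move=> y; left.
  by move=> /(_ u) BuB; apply: nBu; apply: BuB; right.
have ne e' : B e' -> e' != u by move=> Be'; apply: contra_not_neq nBu => <-.
move=> [Be|->] [Bf|->].
- exact: oB.
- by rewrite innerC uB// (negbTE (ne _ Be)).
- by rewrite uB// eq_sym (negbTE (ne _ Bf)).
- by rewrite uu eqxx.
Qed.

Definition onb : set V := xget set0 [set B | orthonormal_basis B].

Lemma onbP : orthonormal_basis onb.
Proof. exact: (xgetPex _ ex_orthonormal_basis). Qed.

(* The trace of a positive operator; it does not depend on the basis. *)
Definition trace S : \bar R := (\esum_(e in onb) (inner e (S e))%:E)%E.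

Definition hs_norm S : R :=
  Num.sqrt (fine (\esum_(e in onb) (`|S e| ^+ 2)%:E)%E).

Definition tensor (a b : V) : V -> V := fun x => inner b x *: a.

End operators.

Section bochner.
Context d (T : measurableType d) (R : realType) (V : normedModType R).
Variables (P : probability T R) (D : set T).

Definition simple_fun (s : T -> V) :=
  finite_set (range s) /\ forall v, measurable (s @^-1` [set v]).

Definition simple_integral (s : T -> V) : V :=
  \sum_(v \in range s) fine (P (D `&` s @^-1` [set v])) *: v.

Definition is_bochner (f : T -> V) (m : V) :=
  exists s : nat -> T -> V,
    [/\ forall n, simple_fun (s n),
        {ae P, forall x, D x -> s n x @[n --> \oo] --> f x},
        (\int[P]_(x in D) (`|f x - s n x|)%:E)%E @[n --> \oo] --> 0%E &
        simple_integral (s n) @[n --> \oo] --> m].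

(* The integral is unique when it exists; 0 is the default value. *)
Definition bochner (f : T -> V) : V := xget 0 [set m | is_bochner f m].

End bochner.

Definition rV_display : measure_display.
Proof. exact: default_measure_display. Qed.

(* The Borel sigma-algebra of R^d. *)
Section measurable_rV.
Context (R : realType) (d : nat).
Local Notation E := 'rV[R]_d.

HB.instance Definition _ := @isMeasurable.Build rV_display E <<s @open E >>
  (@sigma_algebra0 _ setT _) (@sigma_algebraC _ _)
  (@sigma_algebra_bigcup _ setT _).

Definition row_of_tuple (t : d.-tuple (measurableTypeR R)) : E :=
  \row_i tnth t i.

Lemma measurable_row_of_tuple : measurable_fun setT row_of_tuple.
Proof.
apply: measurability => // _ [U oU <-]; rewrite setTI.
pose c (q : 'rV[rat]_d) : E := map_mx ratr q.
pose I := [set qk : 'rV[rat]_d * nat | ball (c qk.1) qk.2.+1%:R^-1 `<=` U].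
have -> : U = \bigcup_(qk in I) ball (c qk.1) (qk.2.+1%:R^-1 : R).
  apply/seteqP; split=> [x Ux|x [qk]]; last by move=> /[apply].
  have /nbhs_ballP[e /= e0 eU] : nbhs x U by exact: open_nbhs_nbhs.
  have [k _ ke] := near_infty_natSinv_lt (PosNum (divr_gt0 e0 (ltr0n R 2))).
  have /= {}ke := ke k (leqnn k).
  have kp : 0 < k.+1%:R^-1 :> R by rewrite invr_gt0.
  have /choice[q qP] i : exists q : rat, `|x 0 i - ratr q| < k.+1%:R^-1.
    have /rat_in_itvoo[q] : x 0 i - k.+1%:R^-1 < x 0 i + k.+1%:R^-1.
      by rewrite ltrD2l gt0_cp.
    by rewrite in_itv/= => /andP[? ?]; exists q; rewrite distrC ltr_distl; apply/andP.
  have cx : ball (c (\row_i q i)) (k.+1%:R^-1 : R) x.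
    by split=> // i j; rewrite !ord1 !mxE -ball_normE/= distrC qP.
  exists (\row_i q i, k) => //= y cy; apply: eU.
  apply: le_ball (ball_triangle (ball_sym cx) cy).
  by rewrite [leRHS]splitr lerD// ltW.
rewrite preimage_bigcup bigcup_mkcond.
apply: countable_bigcupT_measurable => // -[q k]; case: ifPn => // _.
have kp : 0 < k.+1%:R^-1 :> R by rewrite invr_gt0.
rewrite (_ : _ @^-1` _ = \bigcap_(i in [set: 'I_d])
    ((fun t => tnth t i) @^-1` ball (c q 0 i) k.+1%:R^-1)); last first.
  apply/seteqP; split=> [t [_ qt] i _|t qt].
    by have := qt 0 i; rewrite !mxE.
  by split=> // i j; rewrite !ord1 !mxE; have := qt j Logic.I; rewrite /= !mxE.
apply: fin_bigcap_measurable => // i _.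
rewrite -[X in measurable X]setTI; apply: measurable_tnth => //.
exact: measurable_ball.
Qed.

HB.instance Definition _ :=
  isMeasurableFun.Build _ _ _ _ row_of_tuple measurable_row_of_tuple.

End measurable_rV.

Section image_measure.
Context d d' (T : measurableType d) (T' : measurableType d') (R : realType).
Variables (m : {measure set T -> \bar R}) (f : {mfun T >-> T'}).

Definition image_measure : set T' -> \bar R := pushforward m f.

Let image_measure0 : image_measure set0 = 0%E.
Proof. exact: measure0. Qed.

Let image_measure_ge0 A : (0 <= image_measure A)%E.
Proof. exact: measure_ge0. Qed.

Let image_measure_sigma_additive : semi_sigma_additive image_measure.
Proof. exact: measure_semi_sigma_additive. Qed.

HB.instance Definition _ := isMeasure.Build _ _ _ image_measure
  image_measure0 image_measure_ge0 image_measure_sigma_additive.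

End image_measure.

Section cons_tuple.
Context d (T : measurableType d) (n : nat).

Definition cons_pair (z : T * n.-tuple T) : n.+1.-tuple T :=
  [tuple of z.1 :: z.2].

Lemma measurable_cons_pair : measurable_fun setT cons_pair.
Proof. exact: measurable_cons. Qed.

HB.instance Definition _ :=
  isMeasurableFun.Build _ _ _ _ cons_pair measurable_cons_pair.

Section cons_measure.
Context (R : realType).
Variables (m1 : {sigma_finite_measure set T -> \bar R})
  (m2 : {sigma_finite_measure set (n.-tuple T) -> \bar R}).

Definition cons_measure : set (n.+1.-tuple T) -> \bar R :=
  image_measure (m1 \x m2)%E cons_pair.

HB.instance Definition _ := Measure.on cons_measure.

Let cons_measure_sigma_finite : sigma_finite setT cons_measure.
Proof.
have /sigma_finiteP[F [TF ndF Foo]] := sigma_finiteT m1.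
have /sigma_finiteP[G [TG ndG Goo]] := sigma_finiteT m2.
pose uncons (t : n.+1.-tuple T) : (T * n.-tuple T)%type :=
  (thead t, [tuple of behead t]).
have uncons_cons z : uncons (cons_pair z) = z.
  by case: z => x t; congr pair; apply: val_inj.
have mu : measurable_fun setT uncons.
  apply: measurable_fun_pair; first exact: measurable_tnth.
  exact: measurable_behead.
exists (fun k => uncons @^-1` (F k `*` G k)).
  apply/seteqP; split=> // t _.
  have [k _ Fk] : (\bigcup_k F k) (uncons t).1 by rewrite -TF.
  have [l _ Gl] : (\bigcup_k G k) (uncons t).2 by rewrite -TG.
  exists (maxn k l) => //; split.
    by move: Fk; exact/subsetPset/ndF/leq_maxl.
  by move: Gl; exact/subsetPset/ndG/leq_maxr.
move=> k; have [mF Fk] := Foo k; have [mG Gk] := Goo k; split.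
  by rewrite -[X in measurable X]setTI; apply: mu => //; exact: measurableX.
suff -> : cons_measure (uncons @^-1` (F k `*` G k)) = (m1 \x m2)%E (F k `*` G k).
  by rewrite product_measure1E// lte_mul_pinfty// ge0_fin_numE.
congr ((m1 \x m2)%E _); apply/funext => z.
by rewrite /preimage /mkset -[X in (_ `*` _) X]/(uncons (cons_pair z)) uncons_cons.
Qed.

HB.instance Definition _ := Measure_isSigmaFinite.Build _ _ _
  cons_measure cons_measure_sigma_finite.

End cons_measure.

End cons_tuple.

(* The product measure P^n, i.e. the law of n i.i.d. observations from P. *)
Fixpoint iid d (T : measurableType d) (R : realType) (P : probability T R)
    (n : nat) : probability (n.-tuple T) R :=
  match n with
  | 0 => dirac [tuple]
  | n'.+1 => distribution (P \x iid P n')%E (@cons_pair _ T n')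
  end.

Fixpoint lebesgue_tuple (R : realType) (n : nat) :
    {sigma_finite_measure set (n.-tuple (measurableTypeR R)) -> \bar R} :=
  match n with
  | 0 => dirac [tuple]
  | n'.+1 => cons_measure lebesgue_measure (lebesgue_tuple R n')
  end.

Definition lebesgue_rV (R : realType) (d : nat) : set 'rV[R]_d -> \bar R :=
  image_measure (lebesgue_tuple R d) (@row_of_tuple R d).

HB.instance Definition _ (R : realType) (d : nat) := Measure.on (@lebesgue_rV R d).


Section smoothness.
Context (R : realType) (d : nat).
Local Notation E := 'rV[R]_d.
Implicit Types (X : set E) (f : E -> R) (k : E -> E -> R).

Definition partial_derive (i : 'I_d) f (x : E) : R := 'D_(delta_mx 0 i) f x.

(* Functions on X are represented by functions on R^d.  C^1 on X means C^1 on
   an open neighbourhood of X; for open X this is the usual notion.  If X is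
   contained in the closure of its interior, the derivatives at the points of
   X depend only on the values on X. *)
Definition C1_on X f := forall x, X x -> \forall y \near x, forall i,
  derivable f y (delta_mx 0 i) /\ {for y, continuous (partial_derive i f)}.

(* k, its first-order partial derivatives in either argument and its mixed
   derivatives d^2 k / dx_i dy_j exist and are jointly continuous on a
   neighbourhood of X x X. *)
Definition C11_on X k := forall x y, X x -> X y -> \forall z \near (x, y),
  [/\ {for z, continuous (fun w : E * E => k w.1 w.2)},
      forall i, derivable (k ^~ z.2) z.1 (delta_mx 0 i) /\
        {for z, continuous (fun w : E * E => partial_derive i (k ^~ w.2) w.1)},
      forall j, derivable (k z.1) z.2 (delta_mx 0 j) /\
        {for z, continuous (fun w : E * E => partial_derive j (k w.1) w.2)} &
      forall i j,
        derivable (fun x' => partial_derive j (k x') z.2) z.1 (delta_mx 0 i) /\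
        {for z, continuous (fun w : E * E =>
           partial_derive i (fun x' => partial_derive j (k x') w.2) w.1)}].

Definition positive_definite_kernel X k :=
  (forall x y, X x -> X y -> k x y = k y x) /\
  forall (n : nat) (x : 'I_n -> E) (c : 'I_n -> R), (forall i, X (x i)) ->
    0 <= \sum_(i < n) \sum_(j < n) c i * c j * k (x i) (x j).

(* A Hilbert space of functions on X (rkhs_eval f x is the value of f at x)
   with reproducing kernel k.  It is determined by k up to isometry. *)
Record rkhs X k := Rkhs {
  rkhs_space :> hilbertType R ;
  rkhs_eval : rkhs_space -> E -> R ;
  rkhs_eval_linear : forall a (f g : rkhs_space) x, X x ->
    rkhs_eval (a *: f + g) x = a * rkhs_eval f x + rkhs_eval g x ;
  rkhs_eval_inj : forall f : rkhs_space,
    (forall x, X x -> rkhs_eval f x = 0) -> f = 0 ;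
  rkhs_reproducing : forall x, X x -> exists kx : rkhs_space,
    (forall y, X y -> rkhs_eval kx y = k x y) /\
    forall f : rkhs_space, rkhs_eval f x = inner f kx
}.

(* The element of the RKHS that is the function h on X, and 0 if there is
   none.  For k of class C^{1,1} it exists when h is a section k(x, .) or a
   derivative (d/dx_i) k(x, .) with x in X. *)
Definition rkhs_elt X k (H : rkhs X k) (h : E -> R) : H :=
  xget 0 [set f : H | forall y, X y -> rkhs_eval f y = h y].

End smoothness.

Section stein.
Context (R : realType) (d : nat).
Local Notation E := 'rV[R]_d.
Variables (X : set E) (p0 : E -> R) (k : E -> E -> R) (H : rkhs X k).
Implicit Types P : probability E R.

Definition score (i : 'I_d) : E -> R := partial_derive i (@ln R \o p0).

Definition stein_feature (x : E) : hpow d H :=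
  [ffun i => score i x *: rkhs_elt H (k x) +
             rkhs_elt H (fun y => partial_derive i (k ^~ y) x)].

Definition stein_kernel (x y : E) : R :=
  inner (stein_feature x) (stein_feature y).

(* A probability on X is a Borel probability on R^d giving mass 1 to X. *)
Definition stein_admissible P :=
  P X = 1%E /\ (\int[P]_(x in X) (stein_kernel x x)%:E < +oo)%E.

Definition stein_embedding P : hpow d H := bochner P X stein_feature.

Definition ksd P : R := `|stein_embedding P|.

(* E_P[xi tensor xi], integrated pointwise: C f = E_P[(xi tensor xi) f]. *)
Definition stein_cov P (f : hpow d H) : hpow d H :=
  bochner P X (fun x => tensor (stein_feature x) (stein_feature x) f).

Definition stein_class P0 (A : R) : set (probability E R) :=
  [set P | stein_admissible P /\
    (\int[(P \x P)]_(z in X `*` X) (stein_kernel z.1 z.2 ^+ 2)%:E <=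
       A%:E * trace (stein_cov P0 \o stein_cov P0))%E].

Definition estimator (n : nat) : set (n.-tuple E -> R) :=
  [set T | measurable_fun setT T].

Definition minimax_risk P0 (A : R) (n : nat) : \bar R :=
  ereal_inf [set ereal_sup [set (\int[iid P n]_s `|T s - ksd P|%:E)%E
                           | P in stein_class P0 A]
            | T in @estimator n].

End stein.

Arguments stein_cov {R d X} p0 {k} H P f.

(* Main.v *)
(* The constant may depend on P0, so two points suffice.  If tr (C^2) > 0 there
   are a vector v and a Borel set B with E_P0 [1_B <xi, v>] <> 0, while
   E_P0 <xi, v> = 0 by Stein's identity.  The tilting Q of P0 with density
   1 + e (1_B - P0 B) has discrepancy at least e |E_P0 [1_B <xi, v>]| / |v|, and
   e^2 = 1 / (2 n) keeps the second moment of the n-sample likelihood ratio at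
   most 2.  Since the density is at most 2 and E_P0 K^2 <= tr (C^2), Q belongs
   to the class as soon as A >= 4.  Everything rests on xi being strongly
   measurable on X: difference quotients of the kernel sections are Cauchy in the
   RKHS because their inner products are second differences of k, so xi is
   continuous on X. *)

Require Import Defs.
From HB Require Import structures.
From mathcomp Require Import all_boot all_order all_algebra.
From mathcomp Require Import all_classical all_reals all_analysis.
From mathcomp Require Import finmap measurable_realfun ring lra.

Set Implicit Arguments.
Unset Strict Implicit.
Unset Printing Implicit Defensive.
Import Order.TTheory GRing.Theory Num.Theory.
Import numFieldNormedType.Exports.
Local Open Scope classical_set_scope.
Local Open Scope ring_scope.

(** The RKHS is not assumed separable and [onb] comes from Zorn's lemma, so the basis may be
    uncountable. What makes the trace usable is that xi has separable range: there is one sequence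
    of finite subfamilies of [onb] whose projections converge at every value of xi, and expanding
    along it gives the joint measurability of K and the bound on its second moment. The Bochner
    integral is a choice with default value 0, so its existence comes first; afterwards means and
    covariances are handled only through inner products with fixed vectors, that is, through scalar
    integrals. The set X need not be open. Difference quotients may therefore be based at nearby
    points of the interior, and xi is extended by 0 off X so that measurability can be stated on the
    whole space. Tilting by an indicator, and not by <xi, v> itself, keeps the density between 0 and
    2 although xi may be unbounded. The Hilbert-Schmidt norm is a fixed number, which the constant
    absorbs; the risk bound itself only involves |E_P0 [1_B <xi, v>]| / |v|. *)

Section hilbert.
Context (R : realType) (V : hilbertType R).
Implicit Types (x y z e v : V) (s : seq V).

Lemma innerDl x y z : inner (x + y) z = inner x z + inner y z.
Proof. by have := inner_linearl z 1 x y; rewrite !scale1r mul1r. Qed.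

Lemma inner0l x : inner 0 x = 0.
Proof. by apply: (addrI (inner 0 x)); rewrite -innerDl !addr0. Qed.

Lemma innerZl a x y : inner (a *: x) y = a * inner x y.
Proof. by have := inner_linearl y a x 0; rewrite inner0l !addr0. Qed.

Lemma innerNl x y : inner (- x) y = - inner x y.
Proof. by rewrite -scaleN1r innerZl mulN1r. Qed.

Lemma innerBl x y z : inner (x - y) z = inner x z - inner y z.
Proof. by rewrite innerDl innerNl. Qed.

Lemma inner0r x : inner x 0 = 0.
Proof. by rewrite innerC inner0l. Qed.

Lemma innerZr a x y : inner y (a *: x) = a * inner y x.
Proof. by rewrite !(innerC y) innerZl. Qed.

Lemma innerBr x y z : inner z (x - y) = inner z x - inner z y.
Proof. by rewrite !(innerC z) innerBl. Qed.

Lemma inner_suml I (r : seq I) (P : pred I) (F : I -> V) y :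
  inner (\sum_(i <- r | P i) F i) y = \sum_(i <- r | P i) inner (F i) y.
Proof. by apply: (big_morph (fun x => inner x y)) => [u v|]; rewrite ?innerDl ?inner0l. Qed.

Lemma normB_sq x y :
  `|x - y| ^+ 2 = `|x| ^+ 2 - 2 * inner x y + `|y| ^+ 2.
Proof. by rewrite -!inner_normE innerBl !innerBr (innerC y x); ring. Qed.

Lemma inner_le_norm x y : inner x y <= `|x| * `|y|.
Proof.
have [->|x0] := eqVneq x 0; first by rewrite inner0l normr0 mul0r.
have [->|y0] := eqVneq y 0; first by rewrite inner0r normr0 mulr0.
have nx : 0 < `|x| by rewrite normr_gt0.
have ny : 0 < `|y| by rewrite normr_gt0.
have := sqr_ge0 `|(`|y| *: x - `|x| *: y)|.
rewrite normB_sq innerZl innerZr !normrZ !normr_id => h.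
have {}h : 0 <= (2 * (`|x| * `|y|)) * (`|x| * `|y| - inner x y).
  by apply: le_trans h _; rewrite le_eqVlt; apply/orP; left; apply/eqP; ring.
by rewrite pmulr_rge0 ?subr_ge0// in h; rewrite !mulr_gt0.
Qed.

Lemma normr_inner_le x y : `|inner x y| <= `|x| * `|y|.
Proof.
by rewrite ler_norml inner_le_norm lerNl -innerNl -(normrN x) inner_le_norm.
Qed.

Lemma inner_inj x y : (forall v, inner x v = inner y v) -> x = y.
Proof.
move=> xy; apply/eqP; rewrite -subr_eq0 -normr_eq0 -sqrf_eq0 -inner_normE.
by rewrite innerBl xy subrr.
Qed.

Lemma cvg_inner T (F : set_system T) (FF : Filter F) (f g : T -> V) a b :
  f @ F --> a -> g @ F --> b -> inner (f t) (g t) @[t --> F] --> inner a b.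
Proof.
move=> fa gb.
(* Polarization: the inner product is a combination of squared norms, so continuity of the norm
   suffices. *)
have E x y : inner x y = 2^-1 * (`|x| ^+ 2 + `|y| ^+ 2 - `|x - y| ^+ 2).
  by rewrite normB_sq; field.
rewrite E; under eq_fun do rewrite E.
apply: cvgM; first exact: cvg_cst.
apply: cvgB; [apply: cvgD|].
- by rewrite expr2; under eq_fun do rewrite expr2; apply: cvgM; exact: cvg_norm.
- by rewrite expr2; under eq_fun do rewrite expr2; apply: cvgM; exact: cvg_norm.
- rewrite expr2; under eq_fun do rewrite expr2.
  by apply: cvgM; apply: cvg_norm; exact: cvgB.
Qed.

(** * Projections onto finite orthonormal families and approximation along the basis *)

Definition oproj s v : V := \sum_(e <- s) inner v e *: e.

Definition orthoseq s := uniq s /\ {in s &, forall e f, inner e f = (e == f)%:R}.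

Lemma inner_oproj s v x : inner (oproj s v) x = \sum_(e <- s) inner v e * inner x e.
Proof.
by rewrite inner_suml; apply: eq_bigr => e _; rewrite innerZl (innerC e).
Qed.

Lemma inner_oproj_mem s v e : orthoseq s -> e \in s ->
  inner (oproj s v) e = inner v e.
Proof.
move=> [us os] es; rewrite inner_oproj (bigD1_seq e)//= (os e e)// eqxx mulr1.
rewrite big_seq_cond big1 ?addr0// => f /andP[fs fe].
by rewrite (os e f)// eq_sym (negbTE fe) mulr0.
Qed.

Lemma inner_oproj2 s v x : orthoseq s ->
  inner (oproj s v) (oproj s x) = inner (oproj s v) x.
Proof.
move=> os; rewrite !inner_oproj; apply: eq_big_seq => e es.
by rewrite inner_oproj_mem.
Qed.

Lemma norm_oprojB_sq s v : orthoseq s ->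
  `|v - oproj s v| ^+ 2 = `|v| ^+ 2 - \sum_(e <- s) inner v e ^+ 2.
Proof.
move=> os; rewrite normB_sq -[(`|oproj s v| ^+ 2)]inner_normE inner_oproj2//.
rewrite (innerC v) inner_oproj; under eq_bigr do rewrite -expr2.
ring.
Qed.

Lemma norm_oproj_le s v : orthoseq s -> `|oproj s v| <= `|v|.
Proof.
move=> os; rewrite -(@ler_pXn2r _ 2)// ?nnegrE//.
rewrite -[leLHS]inner_normE inner_oproj2// inner_oproj.
under eq_bigr do rewrite -expr2.
by rewrite -subr_ge0 -norm_oprojB_sq// sqr_ge0.
Qed.

Lemma norm_oprojB_le s v : orthoseq s -> `|v - oproj s v| <= `|v|.
Proof.
move=> os; rewrite -(@ler_pXn2r _ 2)// ?nnegrE// norm_oprojB_sq// gerBl.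
by apply: sumr_ge0 => e _; exact: sqr_ge0.
Qed.

Lemma oprojB s v x : oproj s (v - x) = oproj s v - oproj s x.
Proof.
rewrite /oproj -sumrN -big_split; apply: eq_bigr => e _ /=.
by rewrite innerBl scalerBl.
Qed.

Lemma sum_subseq_le s t (F : V -> R) : uniq s -> uniq t -> {subset s <= t} ->
  (forall e, 0 <= F e) -> \sum_(e <- s) F e <= \sum_(e <- t) F e.
Proof.
move=> us ut st F0; rewrite [leRHS](bigID (mem s))/= -[X in X + _]big_filter.
rewrite [X in X + _](perm_big s) ?lerDl ?sumr_ge0//.
apply: uniq_perm => //; first exact: filter_uniq.
move=> e; rewrite mem_filter; case: (boolP (e \in s)) => //= es.
exact: st.
Qed.

Lemma orthoseq_le s t v : orthoseq s -> orthoseq t -> {subset s <= t} ->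
  `|v - oproj t v| <= `|v - oproj s v|.
Proof.
move=> os ot st; rewrite -(@ler_pXn2r _ 2)// ?nnegrE// !norm_oprojB_sq//.
rewrite lerD2l lerN2; apply: sum_subseq_le => //; [exact: os.1|exact: ot.1|].
by move=> e; exact: sqr_ge0.
Qed.

Definition onbseq s := uniq s /\ [set` s] `<=` @onb R V.

Lemma onbseq_ortho s : onbseq s -> orthoseq s.
Proof. by move=> [us sb]; split=> // e f es fs; apply: (onbP V).1; exact: sb. Qed.

Lemma onbseq_undup s t : onbseq s -> onbseq t -> onbseq (undup (s ++ t)).
Proof.
move=> [us sb] [ut tb]; split; first exact: undup_uniq.
by move=> e /=; rewrite mem_undup mem_cat => /orP[/sb|/tb].
Qed.

(* The residuals of best approximants from finite subfamilies are Cauchy by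
   Pythagoras, and their limit is orthogonal to the whole basis. *)
Lemma onb_approx v (eps : R) : 0 < eps ->
  exists2 s, onbseq s & `|v - oproj s v| < eps.
Proof.
pose r s := `|v - oproj s v| ^+ 2.
pose D := inf [set r s | s in onbseq].
have hi : has_inf [set r s | s in onbseq].
  split; first by exists (r [::]); exists [::].
  by exists 0 => _ [s _ <-]; exact: sqr_ge0.
have rD s : onbseq s -> D <= r s by move=> os; apply: ge_inf; [exact: hi.2|exists s].
have D0 : 0 <= D by apply: lb_le_inf; [exact: hi.1|move=> _ [s _ <-]; exact: sqr_ge0].
have near_inf n : exists s, onbseq s /\ r s < D + n.+1%:R^-1.
  have [_ [s os <-] sn] := inf_adherent (ltac:(by []) : 0 < n.+1%:R^-1 :> R) hi.
  by exists s.
have [S /all_and2[oS rS]] := choice near_inf.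
pose w n := v - oproj (S n) v.
have key s t : onbseq s -> onbseq t -> {subset s <= t} ->
    `|oproj t v - oproj s v| ^+ 2 = r s - r t.
  move=> os ot st.
  have oos := onbseq_ortho os; have oot := onbseq_ortho ot.
  rewrite normB_sq /r !norm_oprojB_sq// -!inner_normE !inner_oproj2//.
  have -> : inner (oproj t v) (oproj s v) = inner (oproj s v) v.
    rewrite innerC !inner_oproj; apply: eq_big_seq => e es.
    by rewrite inner_oproj_mem//; exact: st.
  rewrite !inner_oproj; under [\sum_(e <- t) _]eq_bigr do rewrite -expr2.
  under [\sum_(e <- s) _]eq_bigr do rewrite -expr2.
  ring.
(* Both approximants are compared with the one from the union [t]. Its squared residual is at least
   the infimum [D], so by [key] the squared distances to it are below [n.+1%:R^-1] and
   [m.+1%:R^-1]. *)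
have wd n m : `|w n - w m| ^+ 2 <= 2 * (n.+1%:R^-1 + m.+1%:R^-1).
  set t := undup (S n ++ S m).
  have ot : onbseq t by exact: onbseq_undup.
  have nt : {subset S n <= t} by move=> e es; rewrite mem_undup mem_cat es.
  have mt : {subset S m <= t} by move=> e es; rewrite mem_undup mem_cat es orbT.
  have kn := key _ _ (oS n) ot nt; have km := key _ _ (oS m) ot mt.
  have Dt := rD _ ot; have rn := rS n; have rm := rS m.
  have -> : w n - w m = (oproj t v - oproj (S n) v) - (oproj t v - oproj (S m) v).
    have sub3 (a b c : V) : (a - b) - (a - c) = c - b by rewrite opprB addrC addrA subrK.
    by rewrite /w !sub3.
  set a := oproj t v - _ in kn *; set b := oproj t v - _ in km *.
  have : `|a - b| ^+ 2 <= 2 * (`|a| ^+ 2 + `|b| ^+ 2).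
    apply: (@le_trans _ _ ((`|a| + `|b|) ^+ 2)).
      by rewrite lerXn2r// ?nnegrE ?addr_ge0// ler_normB.
    by have := sqr_ge0 (`|a| - `|b|); nra.
  rewrite kn km; move=> h; apply: le_trans h _; clear - Dt rn rm; move: Dt rn rm.
  move: (r (S n)) (r (S m)) (r t) (D) (n.+1%:R^-1) (m.+1%:R^-1) => rn rm rt D' a b *.
  lra.
have wcauchy : cvg (w @ \oo).
  apply: cauchy_cvg; apply: cauchy_exP => e e0.
  have e4 : 0 < e ^+ 2 / 8 by rewrite divr_gt0// exprn_gt0.
  have [N _ Ne] := near_infty_natSinv_lt (PosNum e4).
  exists (w N); exists N => // n /= Nn.
  rewrite -ball_normE /= -(@ltr_pXn2r _ 2)// ?nnegrE//; last exact: ltW.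
  apply: le_lt_trans (wd N n) _.
  have := Ne N (leqnn N); have := Ne n Nn; rewrite /=.
  by move: (e4); move: (N.+1%:R^-1) (n.+1%:R^-1) (e ^+ 2) => a b c' ? ? ?; lra.
have [l wl] := (cvg_ex _).1 wcauchy.
have l0 : l = 0.
  apply: (onbP V).2 => e Be.
  (* Adjoining [e] to [S n] lowers the squared residual by [inner v e ^+ 2], and it cannot fall
     below [D]. *)
  have we n : inner (w n) e ^+ 2 <= n.+1%:R^-1.
    have [eS|eS] := boolP (e \in S n).
      rewrite /w innerBl (inner_oproj_mem _ (onbseq_ortho (oS n)))// subrr.
      by rewrite expr0n/= invr_ge0 ler0n.
    have ot : onbseq (e :: S n).
      split; first by rewrite /= eS (oS n).1.
      by move=> f /=; rewrite inE => /orP[/eqP->//|]; exact: (oS n).2.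
    have := rD _ ot; have := rS n.
    rewrite /r !norm_oprojB_sq ?big_cons//; [|exact: onbseq_ortho..].
    have -> : inner (w n) e = inner v e.
      rewrite /w innerBl inner_oproj big_seq big1 ?subr0// => f fS.
      rewrite (innerC e) ((onbP V).1 f e)//; last exact: (oS n).2.
      have [fe|] := eqVneq f e; last by rewrite mulr0.
      by rewrite -fe fS in eS.
    move: (inner v e ^+ 2) (\sum_(i <- _) _) (`|v| ^+ 2) (D) (n.+1%:R^-1) => a b c' D' i.
    by move=> ? ?; lra.
  apply/eqP; rewrite -sqrf_eq0; apply/eqP.
  have h1 : inner (w n) e ^+ 2 @[n --> \oo] --> inner l e ^+ 2.
    rewrite expr2; under eq_fun do rewrite expr2.
    by apply: cvgM; apply: cvg_inner => //; exact: cvg_cst.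
  have h2 : inner (w n) e ^+ 2 @[n --> \oo] --> (0 : R).
    apply: (squeeze_cvgr _ (cvg_cst (0 : R)) (@cvg_harmonic R)).
    by near=> n; rewrite sqr_ge0 we.
  exact: (cvg_unique _ h1 h2).
move: wl => + eps0; rewrite {}l0 => /cvgr0Pnorm_lt/(_ _ eps0)[N _ /(_ N (leqnn N))].
by exists (S N).
Unshelve. all: by end_near. Qed.

(** Stands in for an enumeration of the basis: one sequence of finite families serves the whole
    closure of a countable set. The family [S n] handles the first [n.+1] points at precision
    [n.+1%:R^-1], and since taking residuals is linear and does not increase norms, the
    approximation passes to limits of the [v j]. *)
Lemma onb_approx_seq (v : nat -> V) : exists S : nat -> seq V,
  (forall n, onbseq (S n)) /\
  forall x, (forall eps, 0 < eps -> exists j, `|x - v j| < eps) ->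
    oproj (S n) x @[n --> \oo] --> x.
Proof.
have ex n : forall m, exists2 s, onbseq s &
    forall j, (j < m)%N -> `|v j - oproj s (v j)| < n.+1%:R^-1.
  elim=> [|m [s os sP]]; first by exists [::].
  have [t ot tP] := onb_approx (v m) (ltac:(by []) : 0 < n.+1%:R^-1 :> R).
  exists (undup (s ++ t)); first exact: onbseq_undup.
  have ou := onbseq_undup os ot.
  move=> j; rewrite ltnS leq_eqVlt => /orP[/eqP->|jm].
    apply: le_lt_trans tP; apply: orthoseq_le; [exact: onbseq_ortho..|].
    by move=> e es; rewrite mem_undup mem_cat es orbT.
  apply: le_lt_trans (sP j jm); apply: orthoseq_le; [exact: onbseq_ortho..|].
  by move=> e es; rewrite mem_undup mem_cat es.
have ex1 n : exists s, onbseq s /\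
    forall j, (j <= n)%N -> `|v j - oproj s (v j)| < n.+1%:R^-1.
  by have [s os sP] := ex n n.+1; exists s.
have [S /all_and2[oS SP]] := choice ex1.
exists S; split=> // x xv; apply/cvgrPdist_lt => e e0.
have e2 : 0 < e / 2 by rewrite divr_gt0.
have [j xj] := xv _ e2; have [N _ Ne] := near_infty_natSinv_lt (PosNum e2).
near=> n.
have -> : x - oproj (S n) x =
    ((x - v j) - oproj (S n) (x - v j)) + (v j - oproj (S n) (v j)).
  by rewrite oprojB opprB addrAC !addrA !subrK.
rewrite (le_lt_trans (ler_normD _ _))// [ltRHS]splitr ltrD//.
  by apply: le_lt_trans xj; apply: norm_oprojB_le; exact: onbseq_ortho.
have jn : (j <= n)%N by near: n; exists j.
apply: lt_trans (SP n j jn) _; apply: Ne => /=; near: n; by exists N.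
Unshelve. all: by end_near. Qed.

End hilbert.

(** * Measurability of Hilbert-valued maps, expressed through distances *)

Section strong_measurability.
Context d (T : measurableType d) (R : realType) (V : hilbertType R).
Implicit Types (f s : T -> V).

(** The range lies in the closure of a countable set; the vectors [v j] themselves need not be
    values of [f]. Distances to fixed vectors replace a Borel sigma-algebra on [V], and they are
    exactly what the construction of simple approximants compares. *)
Definition strongly_measurable f :=
  (exists v : nat -> V, forall x eps, 0 < eps -> exists j, `|f x - v j| < eps) /\
  forall u, measurable_fun setT (fun x => `|f x - u|).

Lemma strongly_measurable_norm f : strongly_measurable f ->
  measurable_fun setT (fun x => `|f x|).
Proof. by move=> [_ /(_ 0)]; under eq_fun do rewrite subr0. Qed.

Lemma strongly_measurable_inner f u : strongly_measurable f ->
  measurable_fun setT (fun x => inner (f x) u).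
Proof.
move=> mf; have [_ mf'] := mf.
rewrite [X in measurable_fun _ X](_ : _ =
  fun x => 2^-1 * (`|f x| ^+ 2 + `|u| ^+ 2 - `|f x - u| ^+ 2)); last first.
  by apply/funext => x; rewrite normB_sq; field.
apply: measurable_funM => //; apply: measurable_funB.
  apply: measurable_funD => //; apply: measurable_funX.
  exact: strongly_measurable_norm.
by apply: measurable_funX; exact: mf'.
Qed.

Lemma mem_range_fset_set s x : finite_set (range s) ->
  s x \in finmap.enum_fset (fset_set (range s)).
Proof.
move=> fs; have : s x \in fset_set (range s) by rewrite in_fset_set//; apply/mem_set; exists x.
by [].
Qed.

Lemma measurable_simple_dep s (F : V -> T -> R) : simple_fun s ->
  (forall w, measurable_fun setT (F w)) ->
  measurable_fun setT (fun x => F (s x) x).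
Proof.
move=> [fs ms] mF.
rewrite [X in measurable_fun _ X](_ : _ = fun x =>
  \sum_(w <- fset_set (range s)) F w x * \1_(s @^-1` [set w]) x); last first.
  apply/funext => x; rewrite (bigD1_seq (s x)) ?mem_range_fset_set ?finmap.fset_uniq//=.
  rewrite indicE mem_set// mulr1 big1 ?addr0// => w wsx.
  by rewrite indicE memNset ?mulr0//= => /esym/eqP; rewrite (negbTE wsx).
apply: measurable_sum => w.
apply: measurable_funM => //.
Qed.

End strong_measurability.

(** * Existence of the Bochner integral and its weak characterization *)

Section bochner_integral.
Context d (T : measurableType d) (R : realType) (V : hilbertType R).
Context (P : probability T R) (D : set T) (f : T -> V).
Implicit Types (s : T -> V) (v : V).
Hypotheses (mD : measurable D) (mf : strongly_measurable f)
  (intf : P.-integrable setT (fun x => (`|f x|)%:E)).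

Lemma integrable_inner v : P.-integrable D (fun x => (inner (f x) v)%:E).
Proof.
apply: (@le_integrable _ _ _ _ _ _ _ (fun x => (`|v|)%:E * (`|f x|)%:E)%E) => //.
- by apply: measurable_funTS; apply/measurable_EFinP; exact: strongly_measurable_inner.
- by move=> x _; rewrite /= lee_fin mulrC normrM !normr_id normr_inner_le.
- by apply: integrableZl => //; apply: integrableS intf.
Qed.

Lemma simple_integral_inner s v : simple_fun s ->
  (inner (simple_integral P D s) v)%:E = (\int[P]_(x in D) (inner (s x) v)%:E)%E.
Proof.
move=> ss; have [fs ms] := ss.
rewrite /simple_integral fsbig_finite// inner_suml.
transitivity (\int[P]_(x in D) (\sum_(w <- fset_set (range s))
    (@inner R V w v)%:E * (\1_(s @^-1` [set w]) x)%:E))%E; last first.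
  apply: eq_integral => x _; rewrite (bigD1_seq (s x)) ?mem_range_fset_set ?finmap.fset_uniq//=.
  rewrite indicE mem_set// mule1 big1 ?adde0// => w wsx.
  by rewrite indicE memNset ?mule0//= => /esym/eqP; rewrite (negbTE wsx).
have ii w : P.-integrable D (fun x => (\1_(s @^-1` [set w]) x)%:E).
  by apply: integrableS (integrable_indic _ (ms w)).
rewrite integral_sum//; last by move=> w; apply: integrableZl.
rewrite -sumEFin; apply: eq_bigr => w _.
rewrite integralZl// integral_indic// innerZl mulrC EFinM fineK ?fin_num_measure//.
- by rewrite setIC.
- exact: measurableI.
Qed.

(** The estimate is tested against a vector because the integral of [f] is not yet known to exist in
    [V], whereas that of [inner (f x) v] is a scalar integral. *)
Lemma simple_integral_dist s v : simple_fun s ->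
  (`|(inner (simple_integral P D s) v)%:E - \int[P]_(x in D) (inner (f x) v)%:E|
   <= (`|v|)%:E * \int[P]_(x in D) (`|f x - s x|)%:E)%E.
Proof.
move=> ss.
have ms : measurable_fun setT (fun x => inner (s x) v).
  by apply: (@measurable_simple_dep _ _ _ _ s (fun w _ => @inner R V w v)).
have mfs : measurable_fun setT (fun x => `|f x - s x|).
  by apply: (@measurable_simple_dep _ _ _ _ s (fun w x => `|f x - w|)) => // w; exact: mf.2.
have is_ : P.-integrable D (fun x => (inner (s x) v)%:E).
  have [fs _] := ss.
  have [M M0] : exists M : R, forall x, `|inner (s x) v| <= M.
    exists (\sum_(w <- fset_set (range s)) `|inner w v|) => x.
    by rewrite (bigD1_seq (s x)) ?mem_range_fset_set ?finmap.fset_uniq//= lerDl sumr_ge0.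
  apply: (@le_integrable _ _ _ _ _ _ _ (EFin \o cst M)) => //.
  - by apply: measurable_funTS; exact/measurable_EFinP.
  - move=> x _; rewrite /= lee_fin (le_trans (M0 x))//; exact: ler_norm.
  - exact: finite_measure_integrable_cst.
rewrite simple_integral_inner// -integralB//; last exact: integrable_inner.
apply: le_trans (le_abse_integral _ _ _) _ => //.
  apply: emeasurable_funB; first exact: measurable_int is_.
  exact: measurable_int (integrable_inner v).
rewrite -ge0_integralZl_EFin//; last first.
  by apply: measurable_funTS; exact/measurable_EFinP.
apply: ge0_le_integral => //.
- apply: measurableT_comp => //; apply: emeasurable_funB; first exact: measurable_int is_.
  exact: measurable_int (integrable_inner v).
- apply: measurable_funTS; apply: measurable_funeM; exact/measurable_EFinP.
- move=> x _; rewrite -EFinB /= lee_fin -innerBl (le_trans (normr_inner_le _ _))//.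
  by rewrite mulrC distrC.
Qed.

Lemma is_bochner_inner (g : T -> V) m v : {in D, g =1 f} -> is_bochner P D g m ->
  (inner m v)%:E = (\int[P]_(x in D) (inner (f x) v)%:E)%E.
Proof.
move=> gf [s [ss _ s0 sm]].
have e0 : (\int[P]_(x in D) (`|f x - s n x|)%:E)%E @[n --> \oo] --> 0%E.
  apply: cvg_trans s0; apply: near_eq_cvg; near=> n.
  by apply: eq_integral => x /gf ->.
have If : (\int[P]_(x in D) (inner (f x) v)%:E)%E \is a fin_num.
  by apply: integrable_fin_num => //; exact: integrable_inner.
rewrite -(fineK If); congr EFin.
have h1 : inner (simple_integral P D (s n)) v @[n --> \oo] --> inner m v.
  by apply: cvg_inner => //; exact: cvg_cst.
have h2 : `|inner (simple_integral P D (s n)) v -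
    fine (\int[P]_(x in D) (inner (f x) v)%:E)| @[n --> \oo] --> (0 : R).
  have B n := simple_integral_dist v (ss n).
  have e1 : (`|v|%:E * \int[P]_(x in D) (`|f x - s n x|)%:E)%E @[n --> \oo] --> 0%E.
    by rewrite -[X in _ --> X](mule0 `|v|%:E); apply: cvgeZl.
  apply: (@fine_cvg _ _ _ _ (fun n => (`|inner (simple_integral P D (s n)) v -
    fine (\int[P]_(x in D) (inner (f x) v)%:E)|)%:E)).
  apply: (squeeze_cvge _ (cvg_cst 0%E) e1); near=> n.
  by rewrite lee_fin normr_ge0/=; have := B n; rewrite -{1}(fineK If).
apply/eqP; rewrite -subr_eq0 -normr_eq0; apply/eqP.
apply: (cvg_unique _ _ h2) => //; apply: cvg_norm; apply: cvgB => //.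
exact: cvg_cst.
Unshelve. all: by end_near. Qed.

Lemma ex_is_bochner (g : T -> V) : {in D, g =1 f} -> exists m, is_bochner P D g m.
Proof.
move=> gf; have [[v vP] _] := mf.
(* Greedy approximation: [s n x] is a point nearest to [f x] among [0] and the first [n] vectors
   [v j]. Starting from [0] keeps the error below [|f x|], which is then the dominating function. *)
pose s := fix s n : T -> V := match n with
  | 0 => cst 0
  | m.+1 => fun x => if `|f x - v m| < `|f x - s m x| then v m else s m x
  end.
have ss n : simple_fun (s n).
  elim: n => [|n IH].
    split; first by apply: (@sub_finite_set _ _ [set 0]) => // _ [x _ <-].
    move=> w; rewrite (_ : _ @^-1` _ = if `[< w = 0 >] then setT else set0).
      by case: ifP.
    by apply/seteqP; case: asboolP => w0; split=> x //= wx; apply: w0.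
  have mfs : measurable_fun setT (fun x => `|f x - s n x|).
    by apply: (@measurable_simple_dep _ _ _ _ (s n) (fun w x => `|f x - w|)) => // w; exact: mf.2.
  pose A := [set x | `|f x - v n| < `|f x - s n x|].
  have mA : measurable A.
    rewrite -[A]setTI.
    have mt : measurable [set true] by [].
    exact: (measurable_fun_ltr (mf.2 (v n)) mfs measurableT mt).
  split.
    apply: (@sub_finite_set _ _ (range (s n) `|` [set v n])).
      move=> _ [x _ <-] /=; case: ifPn => _; first by right.
      by left; exists x.
    by rewrite finite_setU; split=> //; exact: IH.1.
  move=> w; have [vw|vw] := pselect (v n = w).
    rewrite (_ : _ @^-1` _ = A `|` (~` A `&` s n @^-1` [set w])).
      apply: measurableU => //; apply: measurableI; first exact: measurableC.
      exact: IH.2.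
    apply/seteqP; split=> x /=; case: ifPn => h.
    - by left.
    - by move=> sw; right; split=> //; exact/negP.
    - by [].
    - by move=> [|[]//]; rewrite /A /= (negbTE h).
  rewrite (_ : _ @^-1` _ = ~` A `&` s n @^-1` [set w]).
    by apply: measurableI; [exact: measurableC|exact: IH.2].
  apply/seteqP; split=> x /=; case: ifPn => h //.
  - by move=> sw; split=> //; exact/negP.
  - by move=> [].
  - by case.
have dec x n : `|f x - s n.+1 x| <= `|f x - s n x|.
  by rewrite /=; case: ifPn => // /ltW.
have le0 x n : `|f x - s n x| <= `|f x|.
  elim: n => [|n]; first by rewrite /= subr0.
  by apply: le_trans; exact: dec.
have lev x j n : (j < n)%N -> `|f x - s n x| <= `|f x - v j|.
  elim: n => // n IH; rewrite ltnS leq_eqVlt => /orP[/eqP ->|/IH].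
    by rewrite /=; case: ifPn => //; rewrite -leNgt.
  by apply: le_trans; exact: dec.
have sf x : s n x @[n --> \oo] --> f x.
  apply/cvgrPdist_lt => e e0; have [j vj] := vP x _ e0.
  by exists j.+1 => // n /= jn; apply: le_lt_trans vj; exact: lev.
have mfs n : measurable_fun setT (fun x => `|f x - s n x|).
  by apply: (@measurable_simple_dep _ _ _ _ (s n) (fun w x => `|f x - w|)) => // w; exact: mf.2.
have e0 : (\int[P]_(x in D) (`|f x - s n x|)%:E)%E @[n --> \oo] --> 0%E.
  rewrite -(@integral0 _ _ _ P D).
  apply: (@dominated_cvg _ _ _ _ _ mD _ _ (fun x => (`|f x|)%:E)) => //.
  - by move=> n; apply: measurable_funTS; exact/measurable_EFinP.
  - move=> x _; apply: cvg_EFin; first by near=> n.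
    rewrite -(normr0 V); apply: cvg_norm; rewrite -(subrr (f x)).
    by apply: cvgB => //; exact: cvg_cst.
  - by apply: integrableS intf.
  - by move=> n x _; rewrite /= lee_fin normr_id.
pose m n := simple_integral P D (s n).
(* With the difference [m n - m k] itself as test vector, the two scalar estimates add up to a bound
   on its squared norm; one factor of the norm is then cancelled. *)
have dist n k : ((`|m n - m k|)%:E <= \int[P]_(x in D) (`|f x - s n x|)%:E +
    \int[P]_(x in D) (`|f x - s k x|)%:E)%E.
  have [->|w0] := eqVneq (m n - m k) 0.
    by rewrite normr0; apply: adde_ge0; apply: integral_ge0.
  have w1 : 0 < `|m n - m k| by rewrite normr_gt0.
  rewrite -(@lee_pmul2l _ `|m n - m k|%:E)// muleDr//; last first.
    by apply: ge0_adde_def; rewrite inE; apply: integral_ge0.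
  have hn := simple_integral_dist (m n - m k) (ss n).
  have hk := simple_integral_dist (m n - m k) (ss k).
  apply: le_trans (leeD hn hk).
  have If : (\int[P]_(x in D) (inner (f x) (m n - m k))%:E)%E \is a fin_num.
    by apply: integrable_fin_num => //; exact: integrable_inner.
  rewrite -(fineK If) -!EFinB -EFinM !abse_EFin -EFinD lee_fin.
  rewrite -expr2 -inner_normE {1}innerBl.
  set a := inner (m n) _; set b := inner (m k) _; set c := fine _.
  rewrite (_ : a - b = (a - c) - (b - c)); last by ring.
  by rewrite (le_trans (ler_norm _))// ler_normB.
have mc : cvg (m @ \oo).
  apply: cauchy_cvg; apply: cauchy_exP => e e0'.
  have e2 : 0 < e / 2 by rewrite divr_gt0.
  have /fine_cvgP[fin /cvgr0Pnorm_lt/(_ _ e2) small] := e0.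
  have [N _ NP] : \forall n \near \oo,
      (\int[P]_(x in D) (`|f x - s n x|)%:E < (e / 2)%:E)%E.
    near=> n; have h1 : (\int[P]_(x in D) (`|f x - s n x|)%:E)%E \is a fin_num by near: n.
    rewrite -(fineK h1) lte_fin; apply: le_lt_trans (ler_norm _) _.
    by near: n.
  exists (m N); exists N => // n /= Nn; rewrite -ball_normE /= -lte_fin.
  apply: le_lt_trans (dist N n) _; rewrite [e]splitr EFinD.
  by apply: lteD; apply: NP => /=.
exists (lim (m @ \oo)), s; split=> //.
- by apply: aeW => x Dx; rewrite gf; [exact: sf|exact: mem_set].
- apply: cvg_trans e0; apply: near_eq_cvg; near=> n.
  by apply: eq_integral => x /gf ->.
Unshelve. all: by end_near. Qed.

(** All later uses of the integral pass through this formula. Here [g] is the raw integrand, on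
    which nothing is known off [D], and [f] a strongly measurable map on the whole space that agrees
    with it on [D]. *)
Lemma bochner_inner (g : T -> V) v : {in D, g =1 f} ->
  (inner (bochner P D g) v)%:E = (\int[P]_(x in D) (inner (f x) v)%:E)%E.
Proof.
move=> gf; apply: (is_bochner_inner v gf).
exact: (xgetPex _ (ex_is_bochner gf)).
Qed.

End bochner_integral.

(** * The second moment of the kernel and the trace of the squared covariance *)

Section second_moment.
Context d (T : measurableType d) (R : realType) (V : hilbertType R).
Context (P : probability T R) (f : T -> V).
Hypothesis mf : strongly_measurable f.

Let ex_approx : exists S : nat -> seq V, (forall n, onbseq (S n)) /\
  forall x, oproj (S n) (f x) @[n --> \oo] --> f x.
Proof.
have [[v vP] _] := mf; have [S [oS SP]] := onb_approx_seq v.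
by exists S; split=> // x; apply: SP => e e0; exact: vP.
Qed.

Let measurable_oproj s :
  measurable_fun setT (fun z : T * T => inner (oproj s (f z.1)) (f z.2)).
Proof.
under eq_fun do rewrite inner_oproj.
apply: measurable_sum => e; apply: measurable_funM.
  exact: measurableT_comp (strongly_measurable_inner e mf) measurable_fst.
exact: measurableT_comp (strongly_measurable_inner e mf) measurable_snd.
Qed.

(** The kernel is a pointwise limit of finite sums of products of functions of one variable, each
    measurable for the product sigma-algebra. *)
Lemma measurable_inner2 :
  measurable_fun setT (fun z : T * T => inner (f z.1) (f z.2)).
Proof.
have [S [_ SP]] := ex_approx.
apply: (measurable_fun_cvg (fun n => measurable_oproj (S n))) => z _.
by apply: cvg_inner; [exact: SP|exact: cvg_cst].
Qed.

Hypothesis intf : P.-integrable setT (fun x => (`|f x| ^+ 2)%:E).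

Lemma integrable_norm_sq : P.-integrable setT (fun x => (`|f x|)%:E).
Proof.
apply: (@le_integrable _ _ _ _ _ _ _ (fun x => 1%:E + (`|f x| ^+ 2)%:E)%E) => //.
- by apply/measurable_EFinP; exact: strongly_measurable_norm.
- move=> x _; rewrite /= lee_fin normr_id ger0_norm ?addr_ge0 ?sqr_ge0//.
  by have := sqr_ge0 (`|f x| - 1); have := normr_ge0 (f x); nra.
- apply: integrableD => //; exact: finite_measure_integrable_cst.
Qed.

Let mnorm : measurable_fun setT (fun x => `|f x| ^+ 2).
Proof. by apply: measurable_funX; exact: strongly_measurable_norm. Qed.

Let mnorm2 : measurable_fun setT (fun z : T * T => `|f z.1| ^+ 2 * `|f z.2| ^+ 2).
Proof.
by apply: measurable_funM; [exact: measurableT_comp mnorm measurable_fst|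
  exact: measurableT_comp mnorm measurable_snd].
Qed.

Let integrable_norm2 : (P \x P)%E.-integrable setT
  (fun z : T * T => (`|f z.1| ^+ 2 * `|f z.2| ^+ 2)%:E).
Proof.
apply/integrableP; split; first exact/measurable_EFinP.
under eq_integral do rewrite gee0_abs ?lee_fin ?mulr_ge0 ?sqr_ge0//.
rewrite fubini_tonelli1/=; [|exact/measurable_EFinP|]; last first.
  by move=> z; rewrite lee_fin mulr_ge0 ?sqr_ge0.
have fin : (\int[P]_x (`|f x| ^+ 2)%:E \is a fin_num)%E by exact: integrable_fin_num.
set c := (\int[P]_x _)%E in fin.
have sq x : (0 <= (`|f x| ^+ 2)%:E)%E by rewrite lee_fin sqr_ge0.
have msq : measurable_fun setT (fun x => (`|f x| ^+ 2)%:E) by exact/measurable_EFinP.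
rewrite (eq_integral (fun x => c * (`|f x| ^+ 2)%:E)%E); last first.
  move=> x _; rewrite /fubini_F/=; under eq_integral do rewrite EFinM.
  by rewrite ge0_integralZl_EFin ?sqr_ge0// muleC.
rewrite ge0_integralZl//; last exact: integral_ge0.
by rewrite -/c -(fineK fin) -EFinM ltry.
Qed.

Let oproj_le s z : onbseq s ->
  `|inner (oproj s (f z.1)) (f z.2) * inner (f z.1) (f z.2)|
  <= `|f z.1| ^+ 2 * `|f z.2| ^+ 2.
Proof.
move=> os; rewrite normrM -exprMn expr2 ler_pM//; last exact: normr_inner_le.
apply: le_trans (normr_inner_le _ _) _.
by rewrite ler_wpM2r// norm_oproj_le//; exact: onbseq_ortho.
Qed.

(* Expanding the kernel along the basis gives [E K(X,Y)^2 = tr (C^2)]; only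
   this inequality is needed, so the convergence of the trace is not. *)
Lemma integral_inner2_le_trace (C : V -> V) :
  (forall u v, (inner (C u) v)%:E =
    (\int[P]_x (inner (f x) u * inner (f x) v)%:E)%E) ->
  (\int[P \x P]_z (inner (f z.1) (f z.2) ^+ 2)%:E <= trace (C \o C))%E.
Proof.
move=> CP; have [S [oS SP]] := ex_approx.
pose K z := inner (f z.1) (f z.2).
pose Kn n z := inner (oproj (S n) (f z.1)) (f z.2).
have mprod e : measurable_fun setT
    (fun z : T * T => inner (f z.1) e * inner (f z.2) e * K z).
  apply: measurable_funM; last exact: measurable_inner2.
  apply: measurable_funM.
    exact: measurableT_comp (strongly_measurable_inner e mf) measurable_fst.
  exact: measurableT_comp (strongly_measurable_inner e mf) measurable_snd.
have iprod e : (P \x P)%E.-integrable setT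
    (fun z => (inner (f z.1) e * inner (f z.2) e * K z)%:E).
  apply: (@le_integrable _ _ _ _ _ _ _
    (fun z => (`|e| ^+ 2)%:E * (`|f z.1| ^+ 2 * `|f z.2| ^+ 2)%:E)%E) => //.
  - exact/measurable_EFinP.
  - move=> z _; rewrite /= lee_fin (ger0_norm (_ : 0 <= `|e| ^+ 2 * _)); last first.
      by rewrite !mulr_ge0 ?sqr_ge0.
    rewrite (_ : _ * (_ * _) = (`|f z.1| * `|e|) * (`|f z.2| * `|e|) *
      (`|f z.1| * `|f z.2|)); last by ring.
    by rewrite !normrM !ler_pM ?mulr_ge0//; exact: normr_inner_le.
  - exact: integrableZl.
(* By Fubini, integrating over the second variable gives [inner (C e) (f z.1)]; integrating over the
   first then applies [C] once more. *)
have term e : (\int[P \x P]_z (inner (f z.1) e * inner (f z.2) e * K z)%:E)%E =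
    (inner e (C (C e)))%:E.
  rewrite -integral12_prod_meas1// /fubini_F/= innerC CP.
  apply: eq_integral => x _.
  rewrite (innerC (f x) (C e)) [X in _ = X%:E]mulrC EFinM CP -integralZl//.
    apply: eq_integral => y _; rewrite -EFinM; congr EFin.
    by rewrite /K/= (innerC (f x) (f y)); ring.
  apply: (@le_integrable _ _ _ _ _ _ _
    (fun y => (`|e| * `|f x|)%:E * (`|f y| ^+ 2)%:E)%E) => //.
  - apply/measurable_EFinP; apply: measurable_funM; exact: strongly_measurable_inner.
  - move=> y _; rewrite /= lee_fin (ger0_norm (_ : 0 <= `|e| * _ * _)) ?mulr_ge0 ?sqr_ge0//.
    rewrite (_ : _ * _ * _ = (`|f y| * `|e|) * (`|f y| * `|f x|)); last by ring.
    by rewrite !normrM !ler_pM ?mulr_ge0//; exact: normr_inner_le.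
  - exact: integrableZl.
have cvgK : (\int[P \x P]_z (Kn n z * K z)%:E)%E @[n --> \oo] -->
    (\int[P \x P]_z (K z ^+ 2)%:E)%E.
  apply: (@dominated_cvg _ _ _ _ _ measurableT _ _
    (fun z => (`|f z.1| ^+ 2 * `|f z.2| ^+ 2)%:E)) => //.
  - move=> n; apply/measurable_EFinP; apply: measurable_funM; first exact: measurable_oproj.
    exact: measurable_inner2.
  - move=> z _; apply: cvg_EFin; first by near=> n.
    rewrite expr2; apply: cvgM; last exact: cvg_cst.
    by apply: cvg_inner; [exact: SP|exact: cvg_cst].
  - by move=> n z _; rewrite lee_fin; exact: oproj_le.
rewrite -(cvg_lim _ cvgK)//; apply: lime_le; first by apply/cvg_ex; eexists; exact: cvgK.
(* For each [n] the integral is the sum of the diagonal terms over the finite subfamily [S n], one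
   of the sums whose supremum is the trace. *)
near=> n; under eq_integral do rewrite /Kn inner_oproj mulr_suml -sumEFin.
rewrite integral_sum//; under eq_bigr do rewrite term.
rewrite /trace /esum; apply: ereal_sup_ubound; exists [set` S n].
  by split; [exact: finite_seq|exact: (oS n).2].
by rewrite -fsbig_seq; [|exact: (oS n).1].
Unshelve. all: by end_near. Qed.

End second_moment.

(** * Integration against product measures and change of measure *)

Section iid_integral.
Context d (T : measurableType d) (R : realType).
Implicit Types (P Q : probability T R) (n : nat).

Lemma measurable_tuple_prod n (w : T -> R) : measurable_fun setT w ->
  measurable_fun setT (fun t : n.-tuple T => \prod_(i < n) w (tnth t i)).
Proof.
move=> mw; apply: measurable_prod => i _.
by apply: (measurableT_comp mw); exact: measurable_tnth.
Qed.

Lemma tuple_prod_cons n (w : T -> R) x (t : n.-tuple T) :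
  \prod_(i < n.+1) w (tnth (cons_pair (x, t)) i) = w x * \prod_(i < n) w (tnth t i).
Proof.
rewrite big_ord_recl /=; congr (_ * _); apply: eq_bigr => i _.
by rewrite tnthS.
Qed.

Lemma ge0_integral_iid0 P (F : 0.-tuple T -> \bar R) :
  measurable_fun setT F -> (\int[iid P 0]_t F t = F [tuple])%E.
Proof. by move=> mF; rewrite /= integral_dirac// diracT mul1e. Qed.

Lemma ge0_integral_iidS P n (F : n.+1.-tuple T -> \bar R) :
  measurable_fun setT F -> (forall t, 0 <= F t)%E ->
  (\int[iid P n.+1]_t F t = \int[P]_x \int[iid P n]_t F (cons_pair (x, t)))%E.
Proof.
move=> mF F0; rewrite /= ge0_integral_distribution//.
rewrite fubini_tonelli1//; first exact: measurableT_comp mF (@measurable_cons_pair _ T n).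
by move=> z; exact: F0.
Qed.

Lemma measurable_integral_iid P n (F : n.+1.-tuple T -> \bar R) :
  measurable_fun setT F -> (forall t, 0 <= F t)%E ->
  measurable_fun setT (fun x => \int[iid P n]_t F (cons_pair (x, t)))%E.
Proof.
move=> mF F0.
apply: (@measurable_fun_fubini_tonelli_F _ _ _ _ _ (iid P n) (F \o @cons_pair _ T n)).
  exact: measurableT_comp mF (@measurable_cons_pair _ T n).
by move=> z; exact: F0.
Qed.

Lemma measurable_cons_tuple n x : measurable_fun setT (fun t : n.-tuple T => cons_pair (x, t)).
Proof. by apply: measurableT_comp (@measurable_cons_pair _ T n) _; exact: measurable_pair1. Qed.

Lemma integral_iid_prod P n (u : T -> R) (m : R) : measurable_fun setT u ->
  (forall x, 0 <= u x) -> (\int[P]_x (u x)%:E = m%:E)%E ->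
  (\int[iid P n]_t (\prod_(i < n) u (tnth t i))%:E = (m ^+ n)%:E)%E.
Proof.
move=> mu u0 um.
have mp k : measurable_fun setT (fun t : k.-tuple T => (\prod_(i < k) u (tnth t i))%:E).
  by apply/measurable_EFinP; exact: measurable_tuple_prod.
have p0 k (t : k.-tuple T) : (0 <= (\prod_(i < k) u (tnth t i))%:E)%E.
  by rewrite lee_fin prodr_ge0.
elim: n => [|n IH]; first by rewrite ge0_integral_iid0// big_ord0.
rewrite ge0_integral_iidS//.
rewrite (eq_integral (fun x => (m ^+ n)%:E * (u x)%:E)%E); last first.
  move=> x _; under eq_integral do rewrite tuple_prod_cons EFinM.
  by rewrite ge0_integralZl_EFin//; [rewrite IH muleC|exact: mp].
have m0 : 0 <= m by rewrite -lee_fin -um; apply: integral_ge0 => x _; rewrite lee_fin.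
rewrite ge0_integralZl_EFin ?exprn_ge0//; first by rewrite um -EFinM exprSr.
- by move=> x _; rewrite lee_fin.
- exact/measurable_EFinP.
Qed.

Definition has_density P Q (w : T -> R) :=
  [/\ measurable_fun setT w, forall x, 0 <= w x &
      forall F, measurable_fun setT F -> (forall x, 0 <= F x)%E ->
        (\int[Q]_x F x = \int[P]_x ((w x)%:E * F x))%E].

Lemma iid_density P Q w n (F : n.-tuple T -> \bar R) : has_density P Q w ->
  measurable_fun setT F -> (forall t, 0 <= F t)%E ->
  (\int[iid Q n]_t F t =
   \int[iid P n]_t ((\prod_(i < n) w (tnth t i))%:E * F t))%E.
Proof.
move=> [mw w0 QP].
have mp k : measurable_fun setT (fun t : k.-tuple T => (\prod_(i < k) w (tnth t i))%:E).
  by apply/measurable_EFinP; exact: measurable_tuple_prod.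
have p0 k (t : k.-tuple T) : (0 <= (\prod_(i < k) w (tnth t i))%:E)%E.
  by rewrite lee_fin prodr_ge0.
elim: n F => [|n IH] F mF F0.
  rewrite !ge0_integral_iid0 ?big_ord0 ?mul1e//.
  by apply: emeasurable_funM => //; exact: mp.
have mFw : measurable_fun setT
    (fun t => (\prod_(i < n.+1) w (tnth t i))%:E * F t)%E.
  by apply: emeasurable_funM => //; exact: mp.
have Fw0 t : (0 <= (\prod_(i < n.+1) w (tnth t i))%:E * F t)%E by exact: mule_ge0.
rewrite !ge0_integral_iidS// QP; last 2 first.
- exact: measurable_integral_iid.
- by move=> x; exact: integral_ge0.
apply: eq_integral => x _.
have mFx : measurable_fun setT (fun t => F (cons_pair (x, t))).
  by apply: measurableT_comp mF _; exact: measurable_cons_tuple.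
rewrite IH// -ge0_integralZl_EFin//.
- by apply: eq_integral => t _; rewrite tuple_prod_cons muleA EFinM.
- by move=> t _; exact: mule_ge0.
- by apply: emeasurable_funM => //; exact: mp.
Qed.

Lemma density_le P Q w (F : T -> \bar R) (M : R) : has_density P Q w ->
  (forall x, w x <= M) -> measurable_fun setT F -> (forall x, 0 <= F x)%E ->
  (\int[Q]_x F x <= M%:E * \int[P]_x F x)%E.
Proof.
move=> [mw w0 QP] wM mF F0; rewrite QP//.
have M0 : 0 <= M by apply: le_trans (wM point).
rewrite -ge0_integralZl_EFin//; apply: ge0_le_integral => //.
- by move=> x _; rewrite mule_ge0// lee_fin.
- by apply: emeasurable_funM => //; exact/measurable_EFinP.
- by apply: measurable_funeM.
- by move=> x _; rewrite lee_wpmul2r// lee_fin.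
Qed.

Lemma density_prod_le P Q w (F : T * T -> \bar R) (M : R) : has_density P Q w ->
  (forall x, w x <= M) -> measurable_fun setT F -> (forall x, 0 <= F x)%E ->
  (\int[Q \x Q]_z F z <= (M ^+ 2)%:E * \int[P \x P]_z F z)%E.
Proof.
move=> QP wM mF F0.
have M0 : 0 <= M by have [_ w0 _] := QP; apply: le_trans (w0 point) (wM point).
have mFx x : measurable_fun setT (fun y => F (x, y)).
  by apply: measurableT_comp mF _; exact: measurable_pair1.
have mIF (P' : probability T R) : measurable_fun setT (fun x => \int[P']_y F (x, y))%E.
  exact: measurable_fun_fubini_tonelli_F.
rewrite !fubini_tonelli1// /fubini_F.
apply: le_trans (density_le QP wM (mIF Q) _) _.
  by move=> x; exact: integral_ge0.
rewrite expr2 EFinM -muleA lee_wpmul2l ?lee_fin//.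
have I0 x : setT x -> (0 <= \int[P]_y F (x, y))%E by move=> _; exact: integral_ge0.
rewrite -(ge0_integralZl_EFin _ measurableT I0 (mIF P) M0).
apply: ge0_le_integral => //.
- by move=> x _; exact: integral_ge0.
- by apply: measurable_funeM; exact: mIF.
- by move=> x _; exact: (density_le QP).
Qed.

End iid_integral.

(** * Bounded tilting of a probability by the indicator of a set *)

Section tilting.
Context d (T : measurableType d) (R : realType) (P : probability T R).
Context (B : set T) (mB : measurable B).

Definition tilt_density (e : R) x : R := 1 + e * (\1_B x - fine (P B)).

Let ge0_integral_mrestr (F : T -> \bar R) : measurable_fun setT F ->
  (forall x, 0 <= F x)%E ->
  (\int[mrestr P mB]_x F x = \int[P]_x ((\1_B x)%:E * F x))%E.
Proof.
move=> mF F0; rewrite -(setUCr B) ge0_integral_setU//; last 3 first.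
- exact: measurableC.
- by rewrite setUCr.
- by rewrite /disj_set setICr.
rewrite [X in (_ + X)%E]null_set_integral ?adde0//; last 3 first.
- exact: measurableC.
- exact: measurable_funTS.
- by rewrite /= /mrestr setICl measure0.
rewrite (@eq_measure_integral _ _ _ _ P); last first.
  by move=> A mA AB; rewrite /= /mrestr setIidl.
rewrite integral_mkcond setUCr; apply: eq_integral => x _.
by rewrite patchE indicE; case: ifPn => _; rewrite ?mul1e ?mul0e.
Qed.

(** The density is [(1 - e * P B) + e * 1_B], with nonnegative coefficients since [e <= 1], so the
    tilted law is a sum of scaled copies of [P] and of its restriction to [B]. The total mass is
    already 1; [mnormalize] only supplies the structure of a probability. *)
Lemma ex_tilting (e : R) : 0 <= e <= 1 ->
  exists Q : probability T R, has_density P Q (tilt_density e).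
Proof.
move=> /andP[e0 e1]; pose b := fine (P B).
have b0 : 0 <= b by exact: fine_ge0.
have b1 : b <= 1 by rewrite -lee_fin fineK ?fin_num_measure//; exact: probability_le1.
have c0 : 0 <= 1 - e * b by rewrite subr_ge0 mulr_ile1.
pose m : {measure set T -> \bar R} :=
  measure_add (mscale (NngNum c0) P) (mscale (NngNum e0) (mrestr P mB)).
have mT : m setT = 1%E.
  transitivity ((1 - e * b)%:E * P setT + e%:E * P (setT `&` B))%E.
    exact: measure_addE.
  rewrite setTI probability_setT mule1.
  by rewrite -(fineK (fin_num_measure P _ mB)) -EFinM -EFinD subrK.
have mE A : mnormalize m P A = m A.
  by rewrite /mnormalize mT onee_eq0/= invr1 mule1.
exists (mnormalize m P); split.
- apply: measurable_funD => //; apply: measurable_funM => //.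
  by apply: measurable_funB => //; exact: measurable_indic.
- move=> x; rewrite /tilt_density indicE mulrBr addrCA; apply: addr_ge0.
    by rewrite mulr_ge0.
  exact: c0.
move=> F mF F0.
rewrite (@eq_measure_integral _ _ _ _ m); last first.
  by move=> A mA _; rewrite -[LHS]/(mnormalize m P A) mE.
rewrite ge0_integral_measure_add// !ge0_integral_mscale//= ge0_integral_mrestr//.
rewrite -!ge0_integralZl_EFin//; last 2 first.
- by move=> x _; rewrite mule_ge0// lee_fin.
- by apply: emeasurable_funM => //; apply/measurable_EFinP; exact: measurable_indic.
rewrite -ge0_integralD//.
- apply: eq_integral => x _; rewrite muleA -EFinM -ge0_muleDl ?lee_fin ?mulr_ge0//.
  by rewrite -EFinD /tilt_density; congr (_%:E * _)%E; rewrite -/b; ring.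
- by move=> x _; rewrite mule_ge0// lee_fin.
- exact: measurable_funeM.
- by move=> x _; rewrite !mule_ge0// lee_fin.
- apply: measurable_funeM; apply: emeasurable_funM => //.
  by apply/measurable_EFinP; exact: measurable_indic.
Qed.

Lemma tilt_density_le e x : 0 <= e <= 1 -> tilt_density e x <= 2.
Proof.
move=> /andP[e0 e1]; rewrite /tilt_density indicE.
have b0 : 0 <= fine (P B) by exact: fine_ge0.
by case: (x \in B) => /=; nra.
Qed.

Lemma integral_tilt_density_sq e : 0 <= e <= 1 -> exists2 m : R,
  m <= 1 + e ^+ 2 & (\int[P]_x (tilt_density e x ^+ 2)%:E = m%:E)%E.
Proof.
move=> /andP[e0 e1]; set b := fine (P B).
have Pb : P B = b%:E by rewrite fineK ?fin_num_measure.
have b0 : 0 <= b by exact: fine_ge0.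
have b1 : b <= 1 by rewrite -lee_fin -Pb; exact: probability_le1.
(* This is [1 + e ^+ 2 * b * (1 - b)]: centring the indicator cancels the terms linear in [e], so
   the chi-square divergence is of order [e ^+ 2]. *)
exists ((1 - e * b) ^+ 2 + (2 * (1 - e * b) * e + e ^+ 2) * b); first by nra.
have c0 : 0 <= 1 - e * b by rewrite subr_ge0 mulr_ile1.
rewrite (eq_integral (fun x => ((1 - e * b) ^+ 2)%:E +
    (2 * (1 - e * b) * e + e ^+ 2)%:E * (\1_B x)%:E)%E); last first.
  move=> x _; rewrite -EFinM -EFinD /tilt_density -/b; congr EFin.
  by rewrite indicE; case: (x \in B) => /=; ring.
have k0 : 0 <= 2 * (1 - e * b) * e + e ^+ 2 by rewrite addr_ge0 ?mulr_ge0 ?sqr_ge0.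
have mi : measurable_fun setT (fun x => (\1_B x)%:E : \bar R).
  by apply/measurable_EFinP; exact: measurable_indic.
have i0 x : setT x -> (0 <= (\1_B x)%:E :> \bar R)%E by rewrite lee_fin.
rewrite ge0_integralD//.
- rewrite (integral_cst P measurableT) [X in (_ * X + _)%E](probability_setT P) mule1.
  rewrite (ge0_integralZl_EFin _ measurableT i0 mi k0).
  by rewrite integral_indic// setIT [X in (_ + _ * X)%E]Pb -EFinM -EFinD.
- by move=> x _; rewrite lee_fin sqr_ge0.
- by move=> x _; rewrite mule_ge0// lee_fin.
- exact: measurable_funeM.
Qed.

End tilting.

(** * Mean value theorems along lines *)

Section directional_calculus.
Context (R : realType) (E : normedModType R).
Implicit Types (f : E -> R) (x v : E).

Lemma is_derive_line f x v (t : R) : derivable f (t *: v + x) v ->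
  is_derive t 1 (fun s => f (s *: v + x)) ('D_v f (t *: v + x)).
Proof.
have E1 : (fun h : R => h^-1 *: (((fun s => f (s *: v + x)) \o shift t) (h *: 1) -
      f (t *: v + x))) =
    (fun h : R => h^-1 *: ((f \o shift (t *: v + x)) (h *: v) - f (t *: v + x))).
  by apply/funext => h /=; rewrite scalerDl addrA [h *: 1]mulr1.
by move=> df; split; rewrite /derivable /derive E1.
Qed.

Lemma MVT_line f x v (t : R) :
  (forall s : R, `|s| <= `|t| -> derivable f (s *: v + x) v) ->
  exists2 s : R, `|s| <= `|t| & f (t *: v + x) - f x = t * 'D_v f (s *: v + x).
Proof.
move=> df; pose g (s : R) : R := f (s *: v + x); pose dg (s : R) : R := 'D_v f (s *: v + x).
have gd (s : R) : `|s| <= `|t| -> is_derive s 1 g (dg s) by move=> /df; exact: is_derive_line.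
have cg (a b : R) : (forall s, s \in `[a, b] -> `|s| <= `|t|) -> {within `[a, b], continuous g}.
  move=> ab; apply: derivable_within_continuous => s /ab/gd gs.
  by have [] := gs.
have g0 : g 0 = f x by rewrite /g scale0r add0r.
have [t0|t0] := leP 0 t.
  have lt s : s \in `[0, t] -> `|s| <= `|t|.
    by rewrite in_itv/= => /andP[s0 st]; rewrite !ger0_norm.
  have [s st gE] : exists2 s, s \in `[0, t] & g t - g 0 = dg s * (t - 0).
    apply: MVT_segment => //; last exact: cg.
    by move=> s /subset_itv_oo_cc/lt/gd.
  by exists s; [exact: lt|rewrite -g0 -/(g t) gE subr0 mulrC].
have lt s : s \in `[t, 0] -> `|s| <= `|t|.
  by rewrite in_itv/= => /andP[st s0]; rewrite !ler0_norm ?lerN2 // ltW.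
have [s st gE] : exists2 s, s \in `[t, 0] & g 0 - g t = dg s * (0 - t).
  apply: MVT_segment; [exact: ltW| |exact: cg].
  by move=> s /subset_itv_oo_cc/lt/gd.
exists s; [exact: lt|rewrite -g0 -/(g t) -[LHS]opprB gE /dg; ring].
Qed.

(** Only a derivative in the direction [v] is given, so the chain rule is applied to the restriction
    of [f] to a line. *)
Lemma derive_ln f x v : 0 < f x -> derivable f x v ->
  'D_v (@ln R \o f) x = (f x)^-1 * 'D_v f x.
Proof.
move=> fx0 df.
have x0 : x = 0 *: v + x by rewrite scale0r add0r.
have lf : is_derive (0 : R) 1 (fun s => f (s *: v + x)) ('D_v f x).
  by have := @is_derive_line f x v 0; rewrite -x0; apply.
have ld : is_derive (f (0 *: v + x)) 1 (@ln R) (f x)^-1.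
  by rewrite -x0; exact: is_derive1_ln.
have [/= lc <-] := is_derive1_comp ld lf.
rewrite /derive; apply: (congr1 (fun F : R -> R => lim (F @ 0^'))).
apply/funext => h /=.
by rewrite addr0 scale0r add0r [h *: 1]mulr1.
Qed.

(** The mean value theorem is applied twice: in the second argument to the difference [g] of two
    sections of [k], then in the first argument to the derivative so obtained. *)
Lemma second_difference (k : E -> E -> R) x x' v w (t s : R) :
  (forall a b : R, `|a| <= `|t| -> `|b| <= `|s| ->
    derivable (k (a *: v + x)) (b *: w + x') w /\
    derivable (fun y => 'D_w (k y) (b *: w + x')) (a *: v + x) v) ->
  exists a b : R, [/\ `|a| <= `|t|, `|b| <= `|s| &
    k (t *: v + x) (s *: w + x') - k (t *: v + x) x' -
      (k x (s *: w + x') - k x x') =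
    t * s * 'D_v (fun y => 'D_w (k y) (b *: w + x')) (a *: v + x)].
Proof.
move=> dk.
have k0 (b : R) : `|b| <= `|s| -> derivable (k x) (b *: w + x') w.
  move=> bs; have [] := dk 0 b; rewrite ?normr0//.
  by rewrite scale0r add0r.
pose g y := k (t *: v + x) y - k x y.
have dg (b : R) : `|b| <= `|s| -> derivable g (b *: w + x') w.
  move=> bs; apply: derivableB; first by have [] := dk t b.
  exact: k0.
have [b bs gE] := MVT_line dg.
have [a at_ hE] : exists2 a, `|a| <= `|t| &
    'D_w (k (t *: v + x)) (b *: w + x') - 'D_w (k x) (b *: w + x') =
    t * 'D_v (fun y => 'D_w (k y) (b *: w + x')) (a *: v + x).
  apply: (@MVT_line (fun y => 'D_w (k y) (b *: w + x'))) => a at_.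
  by have [] := dk a b.
exists a, b; split=> //.
rewrite (_ : _ - _ = g (s *: w + x') - g x'); last by rewrite /g; ring.
rewrite gE [X in s * X](_ : _ =
    'D_w (k (t *: v + x)) (b *: w + x') - 'D_w (k x) (b *: w + x')).
  by rewrite hE; ring.
rewrite -deriveB//; [by have [] := dk t b|exact: k0].
Qed.

End directional_calculus.

(** * Continuity from partial derivatives, and continuity of the score *)

Section partial_derivatives.
Context (R : realType) (d : nat).
Local Notation E := 'rV[R]_d.
Implicit Types (f : E -> R) (x y : E).

Lemma row_norm_le x (c : R) : 0 <= c -> (`|x| <= c) = [forall i, `|x 0 i| <= c].
Proof.
move=> c0; rewrite /Num.Def.normr/= mx_normrE.
apply/idP/forallP => [xc i|xc].
  apply: le_trans xc; exact: (le_bigmax _ (fun ij => `|x ij.1 ij.2|) (ord0, i)).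
by apply: bigmax_le => // -[i j] _; rewrite (ord1 i) xc.
Qed.

Lemma coord_le_norm x i : `|x 0 i| <= `|x|.
Proof. by have := row_norm_le x (normr_ge0 x); rewrite lexx => /esym/forallP. Qed.

Lemma delta_norm_le i : `|(delta_mx 0 i : E)| <= 1.
Proof.
rewrite row_norm_le//; apply/forallP => j; rewrite mxE eqxx/=.
by case: (j == i); rewrite ?normr1 ?normr0.
Qed.

(** Supplies the continuity of the density, which [C1_on] does not list. The partial derivatives are
    bounded near [x], and changing one coordinate at a time gives a Lipschitz estimate at [x]. *)
Lemma continuous_of_partials f x :
  (\forall y \near x, forall i, derivable f y (delta_mx 0 i)) ->
  (forall i, {for x, continuous (partial_derive i f)}) ->
  {for x, continuous f}.
Proof.
move=> df cf.
have bnd i : \forall y \near x, `|partial_derive i f y| < `|partial_derive i f x| + 1.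
  have /cvgrPdist_lt/(_ 1 ltr01) := cf i; apply: filterS => y h.
  rewrite -ltrBlDl; apply: le_lt_trans h; rewrite distrC.
  by rewrite (le_trans _ (ler_dist_dist _ _))// ler_norm.
pose M := \sum_i (`|partial_derive i f x| + 1).
have M0 : 0 <= M by apply: sumr_ge0 => i _; rewrite addr_ge0.
have Mi i : `|partial_derive i f x| + 1 <= M.
  by rewrite /M (bigD1 i)//= lerDl sumr_ge0// => j _; rewrite addr_ge0.
have [r /= r0 rP] : exists2 r, 0 < r & forall y, `|x - y| < r -> forall i,
    derivable f y (delta_mx 0 i) /\ `|partial_derive i f y| <= M.
  have : \forall y \near x, forall i,
      derivable f y (delta_mx 0 i) /\ `|partial_derive i f y| <= M.
    pose small i y := `|partial_derive i f y| < `|partial_derive i f x| + 1.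
    have bnds : \forall y \near x, forall i, small i y.
      exact: (@filter_forall _ 'I_d small (nbhs x) _ bnd).
    apply: filterS2 df bnds => y dfy by_ i; split=> //.
    by apply: le_trans (Mi i); exact/ltW/by_.
  move=> /nbhs_ballP[r r0 rP]; exists r => // y xy.
  by apply: rP; rewrite -ball_normE.
(* The path from [x] to [y]: the first [j] coordinates are already those of [y]. All points met on
   the way stay within [|x - y|] of [x] in the maximum norm. *)
pose p y j : E := \row_i (if (i < j)%N then y 0 i else x 0 i).
have step y j : `|x - y| < r -> (j <= d)%N ->
    `|f (p y j) - f x| <= j%:R * (M * `|x - y|).
  move=> xy; elim: j => [_|j IH jd].
    rewrite (_ : p y 0 = x) ?subrr ?normr0 ?mul0r//.
    by apply/rowP => i; rewrite mxE.
  pose i := Ordinal jd; pose t := y 0 i - x 0 i.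
  have ts : `|t| <= `|x - y|.
    by rewrite /t distrC; have := coord_le_norm (x - y) i; rewrite !mxE.
  have pS : p y j.+1 = t *: delta_mx 0 i + p y j.
    apply/rowP => l; rewrite !mxE eqxx/=.
    have [->|li] := eqVneq l i; first by rewrite ltnn ltnSn mulr1 subrK.
    rewrite mulr0 add0r ltnS leq_eqVlt; case: eqP => // lj.
    by case/eqP: li; apply: val_inj.
  have near_x s : `|s| <= `|t| -> `|x - (s *: delta_mx 0 i + p y j)| < r.
    move=> st; apply: le_lt_trans xy; rewrite row_norm_le//; apply/forallP => l.
    rewrite !mxE eqxx/=; have [->|li] := eqVneq l i.
      by rewrite ltnn mulr1 opprD addrCA subrr addr0 normrN (le_trans st).
    rewrite mulr0 add0r; case: ifP => _; last by rewrite subrr normr0.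
    by have := coord_le_norm (x - y) l; rewrite !mxE.
  have [s st fE] := MVT_line (fun s h => (rP _ (near_x s h) i).1).
  rewrite pS -(subrK (f (p y j)) (f _)) fE -addrA (le_trans (ler_normD _ _))//.
  rewrite -natr1 [leRHS]mulrDl mul1r [leRHS]addrC lerD ?IH 1?ltnW//.
  by rewrite normrM mulrC ler_pM// (rP _ (near_x s st) i).2.
apply/(@cvgrPdist_lt _ _ _ (nbhs x) (nbhs_filter x) f) => e e0.
have near_x0 (q : R) : 0 < q -> \forall y \near x, `|x - y| < q.
  by move=> q0; apply/nbhs_ballP; exists q => // y; rewrite -ball_normE.
have dM : 0 < d%:R * M + 1 by rewrite ltr_pwDr// mulr_ge0.
near=> y; have xy : `|x - y| < r.
  by near: y; exact: near_x0.
rewrite distrC -[y](_ : p y d = y); last by apply/rowP => i; rewrite mxE ltn_ord.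
apply: le_lt_trans (step y d xy (leqnn d)) _.
apply: (@le_lt_trans _ _ ((d%:R * M + 1) * `|x - y|)).
  by rewrite mulrDl mulrA lerDl mul1r.
rewrite mulrC -ltr_pdivlMr//; near: y.
by apply: near_x0; rewrite divr_gt0.
Unshelve. all: by end_near. Qed.

Lemma score_continuous X (p0 : E -> R) i : C1_on X p0 -> (forall x, X x -> 0 < p0 x) ->
  {within X, continuous (score p0 i)}.
Proof.
move=> p0C p0pos.
apply: (@subspace_eq_continuous _ _ _ (fun x => (p0 x)^-1 * partial_derive i p0 x)).
  move=> x /set_mem Xx; rewrite /from_subspace/= /score /partial_derive derive_ln ?p0pos//.
  by have /nbhs_singleton/(_ i)[] := p0C x Xx.
apply: continuous_in_subspaceT => x /set_mem Xx.
apply: (@cvgM _ _ (nbhs x) (nbhs_filter x) (fun y => (p0 y)^-1) (partial_derive i p0)); last first.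
  by have /nbhs_singleton/(_ i)[] := p0C x Xx.
apply: (@cvgV _ _ (nbhs x) (nbhs_filter x) p0); first by rewrite gt_eqF// p0pos.
apply: continuous_of_partials.
  by have := p0C x Xx; apply: filterS => y h j; have [] := h j.
by move=> j; have /nbhs_singleton/(_ j)[] := p0C x Xx.
Qed.

End partial_derivatives.

(** * Continuity of kernel sections and of their derivatives in the RKHS *)

Section rkhs_feature.
Context (R : realType) (d : nat).
Local Notation E := 'rV[R]_d.
Context (X : set E) (k : E -> E -> R) (H : rkhs X k).
Hypotheses (X_regular : X `<=` closure (interior X)) (k_C11 : C11_on X k).

Let kf x : H := rkhs_elt H (k x).

Lemma rkhs_eltP (h : E -> R) (f : H) : (forall y, X y -> rkhs_eval f y = h y) ->
  rkhs_elt H h = f.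
Proof.
move=> fh; apply/eqP; rewrite -subr_eq0; apply/eqP; apply: (@rkhs_eval_inj _ _ _ _ H).
have eh : [set f : H | forall y, X y -> rkhs_eval f y = h y] (rkhs_elt H h).
  by apply: xgetPex; exists f.
move=> x Xx; rewrite addrC -scaleN1r rkhs_eval_linear// eh// fh//.
by rewrite mulN1r addNr.
Qed.

Lemma rkhs_evalE (f : H) x : X x -> rkhs_eval f x = inner f (kf x).
Proof.
by move=> Xx; have [kx [kxP ->]] := rkhs_reproducing H Xx; rewrite /kf (rkhs_eltP kxP).
Qed.

Lemma inner_kernel x y : X x -> X y -> inner (kf x) (kf y) = k x y.
Proof.
move=> Xx Xy; rewrite -rkhs_evalE//.
have [kx [kxP _]] := rkhs_reproducing H Xx; rewrite /kf (rkhs_eltP kxP).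
exact: kxP.
Qed.

Lemma kernel_section_continuous : {within X, continuous kf}.
Proof.
apply/subspace_continuousP => x Xx.
have kc : {for (x, x), continuous (fun w : E * E => k w.1 w.2)}.
  by have /nbhs_singleton[] := k_C11 Xx Xx.
apply/cvgrPdist_lt => e e0.
have e4 : 0 < e ^+ 2 / 4 by rewrite divr_gt0 ?exprn_gt0.
(* The squared distance is [2 (k x x - k x y) - (k x x - k y y)], below three errors of size
   [e ^+ 2 / 4]. *)
have /cvgrPdist_lt/(_ _ e4) := kc.
move=> [[A B] /= [xA xB] AB]; rewrite near_withinE; near=> y => Xy.
rewrite -(@ltr_pXn2r _ 2)// ?nnegrE//; last exact: ltW.
rewrite normB_sq -!inner_normE !inner_kernel//.
have yA : A y by near: y.
have yB : B y by near: y.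
have := AB (x, y) (conj (nbhs_singleton xA) yB).
have := AB (y, y) (conj yA yB).
rewrite /= !ltr_norml => /andP[a1 a2] /andP[b1 b2].
move: (k x x) (k x y) (k y y) (e ^+ 2) a1 a2 b1 b2 => a b c g *.
lra.
Unshelve. all: by end_near. Qed.

Variable i : 'I_d.
Local Notation v := (delta_mx 0 i : E).

Definition diff_quot x (t : R) : H := t^-1 *: (kf (t *: v + x) - kf x).

(** The base point moves together with the step: at a boundary point [x0] of [X] there may be no
    [t != 0] with [t *: v + x0] in [X], while interior points near [x0] always admit small steps. *)
Definition admissible_step x0 (r : R) x (t : R) :=
  [/\ X x, X (t *: v + x), t != 0, `|x0 - x| < r & `|t| < r].

Let kd (x : E) : H := rkhs_elt H (fun y => partial_derive i (k ^~ y) x).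

Lemma norm_shift_lt x0 x (r t a : R) : `|x0 - x| < r / 2 -> `|t| < r / 2 ->
  `|a| <= `|t| -> `|x0 - (a *: v + x)| < r.
Proof.
move=> xr tr ar; rewrite (_ : _ - _ = (x0 - x) - a *: v); last first.
  by rewrite opprD addrCA addrC.
rewrite (le_lt_trans (ler_normB _ _))// [ltRHS]splitr ltrD//.
rewrite normrZ (le_lt_trans _ tr)// (le_trans _ ar)//.
by rewrite ler_piMr// delta_norm_le.
Qed.

Lemma nbhs_pair_ball (x y : E) (A : set (E * E)) : nbhs (x, y) A ->
  exists2 r : R, 0 < r & forall x' y', `|x - x'| < r -> `|y - y'| < r -> A (x', y').
Proof.
move=> /nbhs_ballP[r /= r0 rA]; exists r => // x' y' xx' yy'.
by apply: rA; split; rewrite -ball_normE.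
Qed.

Lemma diff_quot_cauchy x0 (eps : R) : X x0 -> 0 < eps -> exists2 r : R, 0 < r &
  forall x t x' t', admissible_step x0 r x t -> admissible_step x0 r x' t' ->
    `|diff_quot x t - diff_quot x' t'| < eps.
Proof.
move=> Xx0 eps0.
pose mix (w : E * E) := partial_derive i (fun x' => partial_derive i (k x') w.2) w.1.
have mixc : {for (x0, x0), continuous mix}.
  by have /nbhs_singleton[_ _ _ /(_ i i)[]] := k_C11 Xx0 Xx0.
have e4 : 0 < eps ^+ 2 / 4 by rewrite divr_gt0 ?exprn_gt0.
have /cvgrPdist_lt/(_ _ e4) mixn := mixc.
have [r r0 rP] := nbhs_pair_ball (filterI (k_C11 Xx0 Xx0) mixn).
exists (r / 2); first by rewrite divr_gt0.
(* Diagonal and mixed inner products all approach the same value of the mixed derivative, so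
   [a - 2 b + c] nearly cancels; the tolerance [eps ^+ 2 / 4] is spent with weights 1, 2 and 1. *)
have key x t x' t' : admissible_step x0 (r / 2) x t -> admissible_step x0 (r / 2) x' t' ->
    `|mix (x0, x0) - inner (diff_quot x t) (diff_quot x' t')| < eps ^+ 2 / 4.
  move=> [Xx Xxt t0 xr tr] [Xx' Xxt' t0' xr' tr'].
  have near_x a : `|a| <= `|t| -> `|x0 - (a *: v + x)| < r.
    exact: norm_shift_lt.
  have near_x' b : `|b| <= `|t'| -> `|x0 - (b *: v + x')| < r.
    exact: norm_shift_lt.
  have [|a [b [at_ bt kE]]] := @second_difference R _ k x x' v v t t'.
    move=> a b at_ bt; have [[_ _ k2 k12] _] := rP _ _ (near_x a at_) (near_x' b bt).
    by split; [exact: (k2 i).1|exact: (k12 i i).1].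
  rewrite /diff_quot innerZl innerZr innerBl !innerBr !inner_kernel//.
  rewrite kE [X in _ - X](_ : _ = mix (a *: v + x, b *: v + x')).
    by have [_] := rP _ _ (near_x a at_) (near_x' b bt).
  by rewrite mulrA -invfM mulKf// mulf_neq0.
move=> x t x' t' xt xt'.
rewrite -(@ltr_pXn2r _ 2)// ?nnegrE//; last exact: ltW.
have := key _ _ _ _ xt xt; have := key _ _ _ _ xt xt'; have := key _ _ _ _ xt' xt'.
rewrite normB_sq -!inner_normE !ltr_norml.
move: (mix _) (inner (diff_quot x t) (diff_quot x t))
  (inner (diff_quot x t) (diff_quot x' t'))
  (inner (diff_quot x' t') (diff_quot x' t')) (eps ^+ 2) => M a b c g.
by move=> /andP[? ?] /andP[? ?] /andP[? ?]; lra.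
Qed.

Lemma ex_admissible_step x0 : X x0 -> exists u : nat -> E * R,
  forall n, admissible_step x0 n.+1%:R^-1 (u n).1 (u n).2.
Proof.
move=> Xx0; suff /choice[u uP] : forall n, exists w : E * R,
  admissible_step x0 n.+1%:R^-1 w.1 w.2 by exists u.
move=> n; have n0 : 0 < n.+1%:R^-1 :> R by rewrite invr_gt0.
have [y [iy yb]] : interior X `&` ball x0 (n.+1%:R^-1 : R) !=set0.
  by apply: (X_regular Xx0); exact: nbhsx_ballx.
have /nbhs_ballP[r /= r0 rX] := iy.
pose t := Num.min r n.+1%:R^-1 / 2.
have m0 : 0 < Num.min r n.+1%:R^-1 by rewrite lt_min r0.
have t0 : 0 < t by rewrite divr_gt0.
have tm : t < Num.min r n.+1%:R^-1 by rewrite ltr_pdivrMr// ltr_pMr// ltr1n.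
exists (y, t); split=> /=.
- exact: interior_subset.
- apply: rX; rewrite -ball_normE/= opprD addrCA subrr addr0 normrN normrZ gtr0_norm//.
  rewrite (@le_lt_trans _ _ t) ?ler_piMr ?delta_norm_le ?ltW//.
  by apply: lt_le_trans tm _; rewrite ge_min lexx.
- by rewrite gt_eqF.
- by move: yb; rewrite -ball_normE.
- by rewrite gtr0_norm//; apply: lt_le_trans tm _; rewrite ge_min lexx orbT.
Qed.

Lemma admissible_stepW x0 (r r' : R) x t : r <= r' ->
  admissible_step x0 r x t -> admissible_step x0 r' x t.
Proof. by move=> rr [? ? ? xr tr]; split=> //; exact: lt_le_trans rr. Qed.

(** Completeness gives a limit of the quotients, and evaluating it at each [y] in [X] yields the
    partial derivative of [k] there; functions in the RKHS being determined by their values on [X],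
    the limit is [kd x0]. In particular the derivative of the section belongs to the RKHS and
    [rkhs_elt] does not fall back on its default. *)
Lemma diff_quot_approx x0 (eps : R) : X x0 -> 0 < eps -> exists2 r : R, 0 < r &
  forall x t, admissible_step x0 r x t -> `|kd x0 - diff_quot x t| < eps.
Proof.
move=> Xx0 eps0; have [u uP] := ex_admissible_step Xx0.
have ev (r : R) : 0 < r -> \forall n \near \oo, admissible_step x0 r (u n).1 (u n).2.
  move=> r0; have [N _ Nr] := near_infty_natSinv_lt (PosNum r0).
  by exists N => // n /Nr/= nr; apply: admissible_stepW (uP n); exact: ltW.
pose q n := diff_quot (u n).1 (u n).2.
have cq : cvg (q @ \oo).
  apply: cauchy_cvg; apply: cauchy_exP => e e0.
  have [r r0 rP] := diff_quot_cauchy Xx0 e0; have [N _ NP] := ev _ r0.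
  exists (q N); exists N => // n /= Nn; rewrite -ball_normE/=.
  by apply: rP; apply: NP => /=.
have ql : q @ \oo --> kd x0.
  suff -> : kd x0 = lim (q @ \oo) by [].
  apply: rkhs_eltP => y Xy; rewrite rkhs_evalE//.
  have h1 : inner (q n) (kf y) @[n --> \oo] --> inner (lim (q @ \oo)) (kf y).
    by apply: cvg_inner => //; exact: cvg_cst.
  apply: (cvg_unique _ h1) => //; apply/cvgrPdist_lt => e e0.
  have pc : {for (x0, y), continuous (fun w : E * E => partial_derive i (k ^~ w.2) w.1)}.
    by have /nbhs_singleton[_ /(_ i)[]] := k_C11 Xx0 Xy.
  have /cvgrPdist_lt/(_ _ e0) pn := pc.
  have [r r0 rP] := nbhs_pair_ball (filterI (k_C11 Xx0 Xy) pn).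
  have r2 : 0 < r / 2 by rewrite divr_gt0.
  have := ev _ r2; apply: filterS => n; rewrite /q.
  move: (u n) => [x t]/= [Xx Xxt t0 xr tr].
  have near_x a : `|a| <= `|t| -> `|x0 - (a *: v + x)| < r.
    exact: norm_shift_lt.
  have yy : `|y - y| < r by rewrite subrr normr0.
  have dk a : `|a| <= `|t| -> derivable (k ^~ y) (a *: v + x) v.
    by move=> at_; have [[_ k1 _ _] _] := rP _ _ (near_x a at_) yy; exact: (k1 i).1.
  have [a at_ kE] := MVT_line dk.
  rewrite /diff_quot innerZl innerBl !inner_kernel// kE mulKf//.
  by have [_] := rP _ _ (near_x a at_) yy.
have [r r0 rP] := diff_quot_cauchy Xx0 (ltac:(by rewrite divr_gt0) : 0 < eps / 2).
exists r => // x t xt; have [N _ NP] := ev _ r0.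
have e2 : 0 < eps / 2 by rewrite divr_gt0.
have /cvgrPdist_lt/(_ _ e2)[M _ MP] := ql.
pose n := maxn N M.
rewrite (_ : _ - _ = (kd x0 - q n) + (q n - diff_quot x t)); last by rewrite addrA subrK.
rewrite (le_lt_trans (ler_normD _ _))// [ltRHS]splitr ltrD//.
  by apply: MP; rewrite /= leq_maxr.
by apply: rP => //; apply: NP; rewrite /= leq_maxl.
Qed.

(** A single difference quotient, based close enough to [y], is admissible for both [x] and [y] and
    so approximates both derivatives. *)
Lemma kernel_derivative_continuous : {within X, continuous kd}.
Proof.
apply/subspace_continuousP => x Xx; apply/cvgrPdist_lt => e e0.
have e2 : 0 < e / 2 by rewrite divr_gt0.
have [r r0 rP] := diff_quot_approx Xx e2.
have r2 : 0 < r / 2 by rewrite divr_gt0.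
rewrite near_withinE; apply/nbhs_ballP; exists (r / 2) => // y /= xy Xy.
have {}xy : `|x - y| < r / 2 by move: xy; rewrite -ball_normE.
have [s s0 sP] := diff_quot_approx Xy e2.
have [u uP] := ex_admissible_step Xy.
have m0 : 0 < Num.min s (r / 2) by rewrite lt_min s0.
have [N _ /(_ N (leqnn N))/= Nm] := near_infty_natSinv_lt (PosNum m0).
move: (u N) (uP N) => [x' t]/= /(admissible_stepW (ltW Nm)) ad.
have ady : admissible_step y s x' t by apply: admissible_stepW ad; rewrite ge_min lexx.
have adx : admissible_step x r x' t.
  have [? ? ? yx' tr] : admissible_step y (r / 2) x' t.
    by apply: admissible_stepW ad; rewrite ge_min lexx orbT.
  split=> //; last by apply: lt_trans tr _; rewrite ltr_pdivrMr// ltr_pMr// ltr1n.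
  rewrite (_ : _ - _ = (x - y) + (y - x')); last by rewrite addrA subrK.
  by rewrite (le_lt_trans (ler_normD _ _))// [ltRHS]splitr ltrD.
rewrite (_ : _ - _ = (kd x - diff_quot x' t) - (kd y - diff_quot x' t)); last first.
  by rewrite opprB addrA subrK.
by rewrite (le_lt_trans (ler_normB _ _))// [ltRHS]splitr ltrD// ?rP// sP.
Qed.

End rkhs_feature.

Section stein_feature.
Context (R : realType) (d : nat).
Local Notation E := 'rV[R]_d.

Lemma hpow_norm_le (V : hilbertType R) (f : hpow d V) : `|f| <= \sum_(i < d) `|f i|.
Proof.
have s0 : 0 <= \sum_(i < d) `|f i| by apply: sumr_ge0.
rewrite -(@ler_pXn2r _ 2)// ?nnegrE// -inner_normE -[leLHS]/(hpow_inner f f).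
rewrite /hpow_inner expr2 mulr_suml; apply: ler_sum => i _; rewrite inner_normE expr2 ler_wpM2l//.
by rewrite (bigD1 i)//= lerDl sumr_ge0.
Qed.

Lemma within_continuous_hpow (V : hilbertType R) (X : set E) (f : E -> hpow d V) :
  (forall i, {within X, continuous (fun x => f x i)}) -> {within X, continuous f}.
Proof.
move=> fc; apply/subspace_continuousP => x Xx; apply/cvgrPdist_lt => e e0.
have ed : 0 < e / d.+1%:R by rewrite divr_gt0.
have fi i : \forall y \near x, X y -> `|f x i - f y i| < e / d.+1%:R.
  by have /subspace_continuousP/(_ x Xx)/cvgrPdist_lt/(_ _ ed) := fc i; rewrite near_withinE.
have {}fi := @filter_forall _ 'I_d (fun i => [set y | X y -> `|f x i - f y i| < e / d.+1%:R])
  (nbhs x) (nbhs_filter x) fi.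
rewrite near_withinE; apply: filterS fi => y fy Xy.
apply: le_lt_trans (hpow_norm_le _) _.
apply: (@le_lt_trans _ _ (\sum_(i < d) e / d.+1%:R)).
  by apply: ler_sum => i _; rewrite !ffunE; apply: ltW; exact: fy.
rewrite sumr_const card_ord -[ltLHS]mulr_natr mulrAC ltr_pdivrMr// ltr_pM2l//.
by rewrite ltr_nat.
Qed.

Lemma stein_feature_continuous (X : set E) p0 k (H : rkhs X k) :
  X `<=` closure (interior X) -> C1_on X p0 -> (forall x, X x -> 0 < p0 x) ->
  C11_on X k -> {within X, continuous (stein_feature p0 H)}.
Proof.
move=> Xreg p0C p0pos kC; apply: within_continuous_hpow => i.
have E1 : (fun x => stein_feature p0 H x i) = (fun x => score p0 i x *: rkhs_elt H (k x) +
    rkhs_elt H (fun y => partial_derive i (k ^~ y) x)).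
  by apply/funext => x; rewrite ffunE.
rewrite E1; apply/subspace_continuousP => x Xx.
apply: cvgD.
  apply: cvgZ.
    by have /subspace_continuousP := score_continuous (i := i) p0C p0pos; exact.
  by have /subspace_continuousP := kernel_section_continuous (H := H) kC; exact.
by have /subspace_continuousP := kernel_derivative_continuous (H := H) (i := i) Xreg kC; exact.
Qed.

End stein_feature.

(** * From continuity on a Borel set to strong measurability of the extension by zero *)

Section continuous_strongly_measurable.
Context (R : realType) (d : nat).
Local Notation E := 'rV[R]_d.

Lemma open_measurable_rV (U : set E) : open U -> measurable U.
Proof. by move=> oU; exact: sub_sigma_algebra. Qed.

Lemma within_continuous_measurable (X : set E) (g : E -> R) : measurable X ->
  {within X, continuous g} -> measurable_fun X g.
Proof.
move=> mX /continuousP gc; apply: (measurability _ (RGenOpens.measurableE R)).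
move=> _ [_ [a [b ->] <-]].
have oI : open (g @^-1` `]a, b[%classic : set (subspace X)).
  by apply: gc; exact: interval_open.
have [U oU UE] := (open_subspaceP X _).1 oI.
by rewrite setIC -[X in measurable X]UE; apply: measurableI => //; exact: open_measurable_rV.
Qed.

Lemma rational_ball (x : E) (e : R) : 0 < e ->
  exists q : 'rV[rat]_d, ball (map_mx ratr q : E) e x.
Proof.
move=> e0; have /choice[q qP] i : exists q : rat, `|ratr q - x 0 i| < e.
  have /rat_in_itvoo[q] : x 0 i - e < x 0 i + e by rewrite ltrD2l gt0_cp.
  by rewrite in_itv/= => xq; exists q; rewrite ltr_distl.
by exists (\row_i q i); split=> // i j; rewrite ord1 !mxE -ball_normE/=.
Qed.

Lemma within_continuous_strongly_measurable (V : hilbertType R) (X : set E) (f : E -> V) :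
  measurable X -> {within X, continuous f} ->
  strongly_measurable (fun x => if x \in X then f x else 0).
Proof.
move=> mX fc; split.
  (* A rational centre need not lie in [X], so a point of [X] is chosen in every rational ball that
     meets [X]. In the enumeration below, index [0] is reserved for the value [0] taken off [X]. *)
  pose pt (w : 'rV[rat]_d * nat) : E :=
    xget 0 (X `&` ball (map_mx ratr w.1 : E) (w.2.+1%:R^-1 : R)).
  exists (fun n => if n is m.+1 then
    if @choice.unpickle ('rV[rat]_d * nat)%type m is Some w then f (pt w) else 0
    else 0).
  move=> x e e0; case: ifPn => [/set_mem Xx|_]; last by exists 0%N; rewrite subr0 normr0.
  have /subspace_continuousP/(_ x Xx)/cvgrPdist_lt/(_ _ e0) := fc.
  rewrite near_withinE => /nbhs_ballP[r /= r0 rP].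
  have r2 : 0 < r / 2 by rewrite divr_gt0.
  have [N _ /(_ N (leqnn N))/= Nr] := near_infty_natSinv_lt (PosNum r2).
  have [q qx] := rational_ball x (ltac:(by []) : 0 < N.+1%:R^-1 :> R).
  have [Xp pq] : (X `&` ball (map_mx ratr q : E) (N.+1%:R^-1 : R)) (pt (q, N)).
    by apply: xgetPex; exists x.
  exists (choice.pickle (q, N)).+1; rewrite choice.pickleK; apply: rP => //.
  apply: le_ball (ball_triangle (ball_sym qx) pq).
  by rewrite [leRHS]splitr lerD// ltW.
move=> u.
have mX1 : measurable_fun X (fun x => `|f x - u|).
  apply: within_continuous_measurable => //; apply/subspace_continuousP => x Xx.
  apply: cvg_norm; apply: cvgB; last exact: cvg_cst.
  by have /subspace_continuousP := fc; exact.
rewrite -(setUCr X); apply/measurable_funU => //; first exact: measurableC.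
split.
  by apply: eq_measurable_fun mX1 => x ->.
apply: eq_measurable_fun (measurable_cst `|0 - u|) => x.
by rewrite in_setC => /negbTE ->.
Qed.

End continuous_strongly_measurable.

(** * Le Cam's two-point method through the second moment of the likelihood ratio *)

Section two_points.
Context d (T : measurableType d) (R : realType).

Lemma density_integral (P Q : probability T R) (w g : T -> R) :
  has_density P Q w -> measurable_fun setT g ->
  (\int[Q]_x (g x)%:E = \int[P]_x (w x * g x)%:E)%E.
Proof.
move=> [mw w0 QP] mg; have mg' : measurable_fun setT (EFin \o g) by exact/measurable_EFinP.
rewrite integralE [RHS]integralE !QP//; last 2 first.
- exact: measurable_funeneg.
- exact: measurable_funepos.
congr (_ - _)%E; apply: eq_integral => x _.
  rewrite !funeposE -EFin_max -EFin_max -EFinM; congr EFin.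
  by rewrite maxr_pMr// mulr0.
rewrite !funenegE -EFin_max -EFin_max -EFinM; congr EFin.
by rewrite maxr_pMr// mulr0 mulrN.
Qed.

(* [min 1 l] is bounded below by [l - l ^+ 2 / 4], which only involves the
   first two moments of the likelihood ratio. *)
Lemma le_cam_pointwise (t a l : R) : 0 <= a -> 0 <= l ->
  a * l <= `|t| + l * `|t - a| + a * (l ^+ 2 / 4).
Proof.
move=> a0 l0.
have h1 : a <= `|t| + `|t - a|.
  by apply: le_trans (ler_norm a) _; rewrite -{1}(subKr t a); exact: ler_normB.
have t0 := normr_ge0 t; have ta0 := normr_ge0 (t - a).
have [l1|l1] := leP l 1.
  rewrite -subr_ge0 in l1; have := mulr_ge0 a0 (sqr_ge0 l).
  by have := mulr_ge0 t0 l1; nra.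
rewrite -subr_gt0 in l1; have := mulr_ge0 a0 (sqr_ge0 (l / 2 - 1)).
by have := mulr_ge0 ta0 (ltW l1); nra.
Qed.

(** The target is 0 under [P] and [a] under [Q]. Integrating [le_cam_pointwise] at the likelihood
    ratio [L], whose mean is 1 and second moment [m ^+ n <= 2], gives [a <= S + S + a / 2]. *)
Lemma two_point_bound (P Q : probability T R) w (m a : R) n (F : n.-tuple T -> R) (S : \bar R) :
  has_density P Q w -> (\int[P]_x (w x ^+ 2)%:E = m%:E)%E -> m ^+ n <= 2 ->
  measurable_fun setT F -> 0 <= a ->
  (\int[iid P n]_t `|F t|%:E <= S)%E ->
  (\int[iid Q n]_t `|F t - a|%:E <= S)%E -> ((a / 4)%:E <= S)%E.
Proof.
move=> QP wm m2 mF a0 PS QS; have [mw w0 _] := QP.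
pose L (t : n.-tuple T) := \prod_(i < n) w (tnth t i).
have mL : measurable_fun setT L by exact: measurable_tuple_prod.
have L0 t : 0 <= L t by exact: prodr_ge0.
have L1 : (\int[iid P n]_t (L t)%:E = 1)%E.
  rewrite -(probability_setT (iid Q n)) -[RHS]mul1e -integral_cst// (iid_density QP)//.
  by apply: eq_integral => t _; rewrite mule1.
have L2 : (\int[iid P n]_t (L t ^+ 2)%:E = (m ^+ n)%:E)%E.
  rewrite -(integral_iid_prod n (u := fun x => w x ^+ 2) _ _ wm).
  - by apply: eq_integral => t _; rewrite prodrXl.
  - exact: measurable_funX.
  - by move=> x; exact: sqr_ge0.
have mFa : measurable_fun setT (fun t => `|F t - a|).
  by apply: measurableT_comp => //; exact: measurable_funB.
have mFn : measurable_fun setT (fun t => `|F t|) by exact: measurableT_comp.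
have mL2 : measurable_fun setT (fun t => L t ^+ 2) by exact: measurable_funX.
have QE : (\int[iid Q n]_t `|F t - a|%:E = \int[iid P n]_t (L t * `|F t - a|)%:E)%E.
  rewrite (iid_density QP)//; last exact/measurable_EFinP.
have mLF : measurable_fun setT (fun t => L t * `|F t - a|) by exact: measurable_funM.
have key : (a%:E * \int[iid P n]_t (L t)%:E <= \int[iid P n]_t `|F t|%:E +
    \int[iid P n]_t (L t * `|F t - a|)%:E +
    (a / 4)%:E * \int[iid P n]_t (L t ^+ 2)%:E)%E.
  have a4 : 0 <= a / 4 by rewrite divr_ge0.
  have L20 t : setT t -> (0 <= (L t ^+ 2)%:E)%E by move=> _; rewrite lee_fin sqr_ge0.
  have LF0 t : setT t -> (0 <= (L t * `|F t - a|)%:E)%E by move=> _; rewrite lee_fin mulr_ge0.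
  have eL0 t : setT t -> (0 <= (L t)%:E)%E by move=> _; rewrite lee_fin.
  have F0 t : setT t -> (0 <= `|F t|%:E)%E by [].
  have emL := (measurable_EFinP _ _).2 mL; have emL2 := (measurable_EFinP _ _).2 mL2.
  have emLF := (measurable_EFinP _ _).2 mLF; have emF := (measurable_EFinP _ _).2 mFn.
  rewrite -(ge0_integralZl_EFin _ measurableT eL0 emL a0).
  rewrite -(ge0_integralZl_EFin _ measurableT L20 emL2 a4).
  rewrite -(ge0_integralD _ measurableT F0 emF LF0 emLF).
  have A0 t : setT t -> (0 <= `|F t|%:E + (L t * `|F t - a|)%:E)%E.
    by move=> tT; rewrite adde_ge0 ?F0 ?LF0.
  have B0 t : setT t -> (0 <= (a / 4)%:E * (L t ^+ 2)%:E)%E.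
    by move=> tT; rewrite mule_ge0 ?L20.
  have emA := emeasurable_funD emF emLF; have emB := measurable_funeM (a / 4)%:E emL2.
  rewrite -(ge0_integralD _ measurableT A0 emA B0 emB).
  apply: ge0_le_integral => //.
  - by move=> t _; rewrite mule_ge0 ?lee_fin.
  - exact: measurable_funeM.
  - exact: emeasurable_funD.
  - move=> t _; rewrite -!EFinM -!EFinD lee_fin.
    by rewrite -mulrA [4^-1 * _]mulrC; exact: le_cam_pointwise.
move: key; rewrite L1 L2 -QE mule1 => key.
have {key} : (a%:E <= S + S + (a / 4)%:E * 2%:E)%E.
  apply: le_trans key _; apply: leeD; first exact: leeD.
  by apply: lee_wpmul2l; rewrite lee_fin ?divr_ge0.
have S0 : (0 <= S)%E by apply: le_trans _ PS; apply: integral_ge0 => t _; rewrite lee_fin.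
case: S S0 {PS QS} => [s| |]//= _; last by move=> _; rewrite leey.
by rewrite -EFinM -!EFinD !lee_fin; lra.
Qed.

End two_points.

(** * Moments of the Stein feature under the sampling distribution and its tiltings *)

Section stein_moments.
Context (R : realType) (d : nat).
Local Notation E := 'rV[R]_d.
Context (X : set E) (p0 : E -> R) (k : E -> E -> R) (H : rkhs X k).
Hypotheses (mX : measurable X)
  (feature_cont : {within X, continuous (stein_feature p0 H)}).

(** Continuity controls the feature only on [X]. The extension by zero is strongly measurable
    everywhere and turns integrals over [X] into integrals over the whole space. *)
Let xi x : hpow d H := if x \in X then stein_feature p0 H x else 0.

Let mxi : strongly_measurable xi.
Proof. exact: within_continuous_strongly_measurable. Qed.

Lemma integral_restrict d' (T : measurableType d') (P : {measure set T -> \bar R})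
    (D : set T) (g h : T -> \bar R) :
  (forall x, D x -> g x = h x) -> (forall x, ~ D x -> h x = 0%E) ->
  (\int[P]_(x in D) g x = \int[P]_x h x)%E.
Proof.
move=> gh h0; rewrite integral_mkcond; apply: eq_integral => x _.
by rewrite patchE; case: ifPn => [/set_mem/gh//|]; rewrite notin_setE => /h0.
Qed.

Let xi_in x : X x -> xi x = stein_feature p0 H x.
Proof. by move=> Xx; rewrite /xi mem_set. Qed.

Let xi_out x : ~ X x -> xi x = 0.
Proof. by move=> Xx; rewrite /xi memNset. Qed.

Lemma integral_kernel_diag (P : probability E R) :
  (\int[P]_(x in X) (stein_kernel p0 H x x)%:E = \int[P]_x (`|xi x| ^+ 2)%:E)%E.
Proof.
apply: integral_restrict => x Xx; first by rewrite /stein_kernel inner_normE xi_in.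
by rewrite xi_out// normr0 expr0n.
Qed.

Lemma integral_kernel_sq (P : probability E R) :
  (\int[(P \x P)%E]_(z in X `*` X) (stein_kernel p0 H z.1 z.2 ^+ 2)%:E =
   \int[(P \x P)%E]_z (inner (xi z.1) (xi z.2) ^+ 2)%:E)%E.
Proof.
apply: integral_restrict => -[x y]/=; first by move=> [Xx Xy]; rewrite /stein_kernel !xi_in.
move=> /not_andP[/xi_out ->|/xi_out ->]; first by rewrite inner0l expr0n.
by rewrite inner0r expr0n.
Qed.

Lemma xi_integrable (P : probability E R) : stein_admissible p0 H P ->
  P.-integrable setT (fun x => (`|xi x| ^+ 2)%:E).
Proof.
move=> [_]; rewrite integral_kernel_diag => fin; apply/integrableP; split.
  by apply/measurable_EFinP; apply: measurable_funX; exact: strongly_measurable_norm.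
by under eq_integral do rewrite gee0_abs ?lee_fin ?sqr_ge0//.
Qed.

Lemma stein_embedding_inner (P : probability E R) v : stein_admissible p0 H P ->
  (inner (stein_embedding p0 H P) v)%:E = (\int[P]_x (inner (xi x) v)%:E)%E.
Proof.
move=> aP; rewrite (bochner_inner mX mxi (integrable_norm_sq mxi (xi_integrable aP))).
  by apply: integral_restrict => // x Xx; rewrite xi_out// inner0l.
by move=> x /set_mem/xi_in.
Qed.

Lemma stein_cov_inner (P : probability E R) u v : stein_admissible p0 H P ->
  (inner (stein_cov p0 H P u) v)%:E = (\int[P]_x (inner (xi x) u * inner (xi x) v)%:E)%E.
Proof.
move=> aP.
pose f x := tensor (stein_feature p0 H x) (stein_feature p0 H x) u.
pose f' x := if x \in X then f x else 0.
have f'E x : f' x = inner (xi x) u *: xi x.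
  rewrite /f' /f /tensor /xi; case: ifP => // _; by rewrite scaler0.
have fc : {within X, continuous f}.
  apply/subspace_continuousP => x Xx.
  have xc : stein_feature p0 H y @[y --> within X (nbhs x)] --> stein_feature p0 H x.
    by have /subspace_continuousP := feature_cont; exact.
  by apply: cvgZ => //; apply: cvg_inner => //; exact: cvg_cst.
have mf' : strongly_measurable f' by exact: within_continuous_strongly_measurable.
have if' : P.-integrable setT (fun x => `|f' x|%:E).
  apply: (@le_integrable _ _ _ _ _ _ _ (fun x => `|u|%:E * (`|xi x| ^+ 2)%:E)%E) => //.
  - by apply/measurable_EFinP; exact: strongly_measurable_norm.
  - move=> x _; rewrite /= lee_fin normr_id ger0_norm ?mulr_ge0 ?sqr_ge0//.
    rewrite f'E normrZ expr2 mulrA ler_wpM2r// mulrC; exact: normr_inner_le.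
  - by apply: integrableZl => //; exact: xi_integrable.
rewrite (bochner_inner mX mf' if' (g := f)); last by move=> x xX; rewrite /f' xX.
apply: integral_restrict => x Xx; first by rewrite f'E innerZl.
by rewrite xi_out// inner0l mul0r.
Qed.

Lemma kernel_sq_le_trace (P : probability E R) : stein_admissible p0 H P ->
  (\int[(P \x P)%E]_(z in X `*` X) (stein_kernel p0 H z.1 z.2 ^+ 2)%:E <=
   trace (stein_cov p0 H P \o stein_cov p0 H P))%E.
Proof.
move=> aP; rewrite integral_kernel_sq.
apply: (integral_inner2_le_trace mxi (xi_integrable aP)) => u v.
exact: stein_cov_inner.
Qed.

Lemma tilted_stein_class (P Q : probability E R) w (A : R) : 4 <= A ->
  stein_admissible p0 H P -> has_density P Q w -> (forall x, w x <= 2) ->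
  stein_admissible p0 H Q /\
  (\int[(Q \x Q)%E]_(z in X `*` X) (stein_kernel p0 H z.1 z.2 ^+ 2)%:E <=
   A%:E * trace (stein_cov p0 H P \o stein_cov p0 H P))%E.
Proof.
move=> A4 aP QP w2; have [PX _] := aP; split; first split.
- have mXC := measurableC mX.
  have : (Q (~` X) <= 2%:E * P (~` X))%E.
    have : (\int[Q]_x (\1_(~` X) x)%:E <= 2%:E * \int[P]_x (\1_(~` X) x)%:E)%E.
      apply: (density_le QP w2) => [|x]; last by rewrite lee_fin.
      by apply/measurable_EFinP; exact: measurable_indic.
    by rewrite !integral_indic// !setIT.
  rewrite !probability_setC// PX subee// mule0.
  rewrite -(fineK (fin_num_measure Q _ mX)) -EFinB lee_fin subr_le0 => Q1.
  apply/eqP; rewrite eq_le !lee_fin Q1 andbT -lee_fin fineK ?fin_num_measure//.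
  exact: probability_le1.
- have mn : measurable_fun setT (fun x => (`|xi x| ^+ 2)%:E).
    by apply/measurable_EFinP; apply: measurable_funX; exact: strongly_measurable_norm.
  rewrite integral_kernel_diag.
  have n0 x : (0 <= (`|xi x| ^+ 2)%:E)%E by rewrite lee_fin sqr_ge0.
  apply: le_lt_trans (density_le QP w2 mn n0) _.
  have fin := integrable_fin_num measurableT (xi_integrable aP).
  by rewrite -(fineK fin) -EFinM ltry.
- rewrite integral_kernel_sq.
  have mk : measurable_fun setT (fun z : E * E => (inner (xi z.1) (xi z.2) ^+ 2)%:E).
    by apply/measurable_EFinP; apply: measurable_funX; exact: measurable_inner2.
  have k0 z : (0 <= (inner (xi z.1) (xi z.2) ^+ 2)%:E)%E by rewrite lee_fin sqr_ge0.
  apply: le_trans (density_prod_le QP w2 mk k0) _.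
  apply: lee_pmul => //.
  + exact: integral_ge0.
  + by rewrite lee_fin expr2 -natrM.
  + by rewrite -integral_kernel_sq; exact: kernel_sq_le_trace.
Qed.

(** By contradiction: if [inner (xi x) v] integrates to 0 over every Borel set, it vanishes almost
    everywhere. If this holds for every [v], all the [inner (C u) v] are 0, hence the operator and
    its trace are 0. *)
Lemma stein_cov_witness (P : probability E R) : stein_admissible p0 H P ->
  (0 < trace (stein_cov p0 H P \o stein_cov p0 H P))%E ->
  exists B v, measurable B /\ (\int[P]_(x in B) (inner (xi x) v)%:E != 0)%E.
Proof.
move=> aP tr0; apply: contrapT => noB.
have {}noB B v : measurable B -> (\int[P]_(x in B) (inner (xi x) v)%:E = 0)%E.
  by move=> mB; apply: contrapT => /eqP h; apply: noB; exists B, v.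
have C0 u : stein_cov p0 H P u = 0.
  apply: inner_inj => v; rewrite inner0l; apply: EFin_inj; rewrite stein_cov_inner//.
  have mi v' : measurable_fun setT (fun x => (inner (xi x) v')%:E).
    by apply/measurable_EFinP; exact: strongly_measurable_inner.
  have int_v : P.-integrable setT (fun x => (inner (xi x) v)%:E).
    apply: (integrable_inner measurableT mxi).
    exact: integrable_norm_sq mxi (xi_integrable aP).
  have ae0 : ae_eq P setT (fun x => (inner (xi x) v)%:E) (cst 0%E).
    apply: integral_ae_eq => // B _ mB; rewrite noB//.
    by rewrite integral0.
  rewrite (ae_eq_integral (cst 0%E)) ?integral0//.
    by under eq_fun do rewrite EFinM; exact: emeasurable_funM.
  apply: filterS ae0 => x /(_ Logic.I) h _; rewrite EFinM h.
  by rewrite /= mule0.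
move: tr0; rewrite /trace esum1 ?ltxx// => e _.
by rewrite /= C0 inner0r.
Qed.

End stein_moments.

(** Bounds the second moment of the sample likelihood ratio. From [1 + x <= expR x] the power is at
    most [expR (2^-1)], and the same inequality at [- 2^-1] bounds that by 2. *)
Lemma expR_half_le (R : realType) n : (1 + (2 * n.+1%:R)^-1) ^+ n.+1 <= 2 :> R.
Proof.
have h : expR (2^-1) <= 2 :> R.
  have := expR_ge1Dx (- 2^-1 : R); rewrite expRN => h.
  have e0 := expR_gt0 (2^-1 : R).
  rewrite -(@ler_pM2r _ (expR 2^-1)^-1) ?invr_gt0// mulfV ?gt_eqF//.
  by lra.
apply: le_trans h.
have -> : 2^-1 = (2 * n.+1%:R)^-1 * n.+1%:R :> R.
  by rewrite invfM -mulrA mulVf// mulr1.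
rewrite expRM_natr lerXn2r// ?nnegrE ?expR_ge0 ?addr_ge0 ?invr_ge0 ?mulr_ge0//.
exact: expR_ge1Dx.
Qed.

(** * The alternative at distance of order [n ^ (-1/2)] and the constant *)

Theorem theorem5 (R : realType) (d : nat) (X : set 'rV[R]_d)
    (P0 : probability 'rV[R]_d R) (p0 : 'rV[R]_d -> R)
    (k : 'rV[R]_d -> 'rV[R]_d -> R) (H : rkhs X k) (A : R)
    (X_measurable : measurable X)
    (X_regular : X `<=` closure (interior X))
    (p0_C1 : C1_on X p0)
    (p0_gt0 : forall x, X x -> 0 < p0 x)
    (p0_density : forall B, measurable B ->
      P0 B = (\int[@lebesgue_rV R d]_(x in B `&` X) (p0 x)%:E)%E)
    (k_C11 : C11_on X k)
    (k_pd : positive_definite_kernel X k)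
    (P0_admissible : stein_admissible p0 H P0)
    (stein_identity : stein_embedding p0 H P0 = 0)
    (trace_gt0 : (0 < trace (stein_cov p0 H P0 \o stein_cov p0 H P0))%E)
    (A_ge4 : 4 <= A) :
  exists c : R, 0 < c /\
    \forall n \near \oo,
      ((c * Num.sqrt (hs_norm (stein_cov p0 H P0) / n%:R))%:E <=
         minimax_risk p0 H P0 A n)%E.
Proof.
have fc : {within X, continuous (stein_feature p0 H)}.
  exact: stein_feature_continuous.
pose xi x : hpow d H := if x \in X then stein_feature p0 H x else 0.
have mxi : strongly_measurable xi by exact: within_continuous_strongly_measurable.
have [B [v [mB]]] := stein_cov_witness X_measurable fc P0_admissible trace_gt0.
rewrite -/xi => kne0.
pose g x := inner (xi x) v.
have mg : measurable_fun setT g by exact: strongly_measurable_inner.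
have ig : P0.-integrable setT (EFin \o g).
  apply: (integrable_inner measurableT mxi).
  exact: integrable_norm_sq mxi (xi_integrable X_measurable fc P0_admissible).
have igB : P0.-integrable B (EFin \o g) by exact: integrableS ig.
have g0 : (\int[P0]_x (g x)%:E = 0)%E.
  by rewrite -(stein_embedding_inner X_measurable fc v P0_admissible) stein_identity inner0l.
pose kap := fine (\int[P0]_(x in B) (g x)%:E)%E.
have kapE : (\int[P0]_(x in B) (g x)%:E = kap%:E)%E by rewrite fineK ?integrable_fin_num.
have kap0 : kap != 0 by move: kne0; rewrite kapE eqe.
have v0 : 0 < `|v|.
  rewrite normr_gt0; apply: contra_neq kap0 => v0.
  rewrite /kap /g v0; under eq_integral do rewrite inner0r.
  by rewrite integral0.
(* Discrepancy gained per unit of tilting: Cauchy-Schwarz with [v] will give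
   [e * K <= ksd p0 H Q]. *)
pose K := `|kap| / `|v|.
have K0 : 0 < K by apply: divr_gt0 => //; rewrite normr_gt0.
set hs := hs_norm _.
(* The two-point bound will be [e * K / 4], and with [e = (2 n)^(-1/2)] the target rate
   [sqrt (hs / n)] is [sqrt (2 hs) * e]. The [+ 1] keeps the denominator positive whatever the value
   of [hs]. *)
pose c := K / (4 * (Num.sqrt (2 * hs) + 1)).
have s0 : 0 < Num.sqrt (2 * hs) + 1 by rewrite ltr_pwDr ?sqrtr_ge0.
exists c; split; first by apply: divr_gt0 => //; exact: mulr_gt0.
(* Every sample size from 1 on works; it is written [n.+1] from here. *)
exists 1%N => // -[//|n] _ /=.
pose e : R := (Num.sqrt (2 * n.+1%:R))^-1.
have n0 : 0 < 2 * n.+1%:R :> R by apply: mulr_gt0.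
have e0 : 0 < e by rewrite invr_gt0 sqrtr_gt0.
have e2 : e ^+ 2 = (2 * n.+1%:R)^-1 by rewrite exprVn sqr_sqrtr// ltW.
have e01 : 0 <= e <= 1.
  rewrite ltW//= invf_le1 ?sqrtr_gt0// -(@ler_pXn2r _ 2)// ?nnegrE ?sqrtr_ge0//.
  rewrite (sqr_sqrtr (ltW n0)) expr1n.
  by rewrite -natrM ler1n.
have [Q QP] := ex_tilting P0 mB e01.
have [aQ cQ] := tilted_stein_class X_measurable fc A_ge4 P0_admissible QP
  (fun x => tilt_density_le P0 B x e01).
have [m m1 mE] := integral_tilt_density_sq P0 mB e01.
(* The density of [Q] is a constant plus [e] times the indicator of [B]; the constant contributes
   nothing by Stein's identity. *)
have gQ : inner (stein_embedding p0 H Q) v = e * kap.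
  apply: EFin_inj; rewrite (stein_embedding_inner X_measurable fc v aQ) -/xi.
  rewrite (density_integral QP mg).
  rewrite (eq_integral (fun x => (1 - e * fine (P0 B))%:E * (g x)%:E +
      e%:E * ((EFin \o g) \_ B) x)%E); last first.
    move=> x _; rewrite patchE /tilt_density indicE /=.
    by case: ifP => _; rewrite ?mule0 -?EFinM -?EFinD ?adde0; congr EFin => /=; ring.
  have igr : P0.-integrable setT ((EFin \o g) \_ B) by exact/(integrable_mkcond _ mB).
  rewrite integralD//; [|exact: integrableZl..].
  rewrite !integralZl// g0 mule0 add0e -integral_mkcond EFinM.
  by rewrite -kapE.
have ksdQ : e * K <= ksd p0 H Q.
  rewrite /K mulrA ler_pdivrMr// -{1}(ger0_norm (ltW e0)) -normrM -gQ.
  exact: normr_inner_le.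
apply/ereal_infP => _ [F mF <-].
set S := ereal_sup _.
have QS : (\int[iid Q n.+1]_s `|F s - ksd p0 H Q|%:E <= S)%E.
  by apply: ereal_sup_ubound; exists Q.
(* The other hypothesis is [P0] itself: its discrepancy is 0, and it lies in the class because
   [A >= 1]. *)
have PS : (\int[iid P0 n.+1]_s `|F s|%:E <= S)%E.
  apply: ereal_sup_ubound; exists P0; last first.
    by apply: eq_integral => s _; rewrite /ksd stein_identity normr0 subr0.
  split=> //; apply: le_trans (kernel_sq_le_trace X_measurable fc P0_admissible) _.
  by rewrite lee_pemull ?(ltW trace_gt0)// lee_fin (le_trans _ A_ge4)// ler1n.
have m0 : 0 <= m by rewrite -lee_fin -mE; apply: integral_ge0 => x _; rewrite lee_fin sqr_ge0.
have mn : m ^+ n.+1 <= 2.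
  apply: le_trans (expR_half_le R n); apply: lerXn2r; rewrite ?nnegrE//.
  by rewrite -e2.
apply: le_trans (two_point_bound QP mE mn mF (normr_ge0 _) PS QS).
rewrite lee_fin; apply: (@le_trans _ _ (e * K / 4)); last by rewrite ler_pM2r.
have -> : hs / n.+1%:R = (2 * hs) * e ^+ 2 by rewrite e2; field; rewrite gt_eqF.
rewrite sqrtrM; last by rewrite mulr_ge0// sqrtr_ge0.
rewrite sqrtr_sqr (ger0_norm (ltW e0)) /c.
have q1 : Num.sqrt (2 * hs) / (Num.sqrt (2 * hs) + 1) <= 1.
  by rewrite ler_pdivrMr// mul1r lerDl.
have eK : 0 <= e * K / 4 by apply: divr_ge0 => //; apply: mulr_ge0; exact: ltW.
rewrite -[leRHS]mulr1; apply: le_trans (ler_wpM2l eK q1).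
rewrite le_eqVlt; apply/orP; left; apply/eqP; field.
by rewrite gt_eqF.
Qed.
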